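(* Let $x_1,x_2,\dots$ be i.i.d. random vectors in $\mathbb{R}^p$ with distribution $N(0,\Sigma)$, $\Sigma$ positive definite, and let $\tau>0$. For each $n$, run the Gaussian blurring mean-shift on the first $n$ samples: $x_{i,n}^{(0)}=x_i$ and $x_{i,n}^{(t+1)}=\frac{\sum_{j=1}^n f(x_{i,n}^{(t)}-x_{j,n}^{(t)})x_{j,n}^{(t)}}{\sum_{j=1}^n f(x_{i,n}^{(t)}-x_{j,n}^{(t)})}$ for $i=1,\dots,n$, with $f(u)=\exp(-u^\top u/(2\tau^2))$ (so all weights equal $1$). For each $n$, all $x_{i,n}^{(t)}$ ($i=1,\dots,n$) converge as $t\to\infty$ to a common limit $c_n\in\mathbb{R}^p$. Then, for each fixed $i$, $\lim_{n\to\infty}\lim_{t\to\infty}x_{i,n}^{(t)}=0$ almost surely, i.e. $c_n\to 0$ almost surely. *)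

(* Defs.v *)
From HB Require Import structures.
From mathcomp Require Import all_boot all_order all_algebra.
From mathcomp Require Import all_classical all_reals all_analysis.
Set Implicit Arguments. Unset Strict Implicit. Unset Printing Implicit Defensive.
Import Order.TTheory GRing.Theory Num.Theory.
Import numFieldNormedType.Exports.
Local Open Scope classical_set_scope.
Local Open Scope ring_scope.

Definition posdef {R : realType} {p : nat} (S : 'M[R]_p) : Prop :=
  S^T = S /\ forall v : 'rV[R]_p, v != 0 -> 0 < (v *m S *m v^T) 0 0.

Definition random_vector {d : measure_display} {Omega : measurableType d}
  {R : realType} {p : nat} (X : Omega -> 'rV[R]_p) : Prop :=
  forall k : 'I_p, measurable_fun setT (fun w => X w 0 k).

Definition sigma_of {d : measure_display} {Omega : measurableType d}
  {R : realType} {p : nat} (X : Omega -> 'rV[R]_p) : set (set Omega) :=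
  smallest (sigma_algebra setT)
    [set E | exists (k : 'I_p) (B : set R), measurable B /\
             E = (fun w => X w 0 k) @^-1` B].

Definition mutually_independent {d : measure_display} {Omega : measurableType d}
  {R : realType} {p : nat} (P : probability Omega R)
  (X : nat -> Omega -> 'rV[R]_p) : Prop :=
  forall (s : seq nat) (E : nat -> set Omega),
    uniq s -> (forall i, i \in s -> sigma_of (X i) (E i)) ->
    P (\big[setI/setT]_(i <- s) E i) = (\prod_(i <- s) P (E i))%E.

(* X ~ N(0, S): every non-trivial linear combination a^T X is a real
   centered normal with variance a^T S a (standard deviation sqrt(a^T S a)). *)
Definition gaussian_vector {d : measure_display} {Omega : measurableType d}
  {R : realType} {p : nat} (P : probability Omega R) (S : 'M[R]_p)
  (X : Omega -> 'rV[R]_p) : Prop :=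
  forall a : 'rV[R]_p, a != 0 -> forall B : set R, measurable B ->
    P [set w | (X w *m a^T) 0 0 \in B]
    = normal_prob 0 (Num.sqrt ((a *m S *m a^T) 0 0)) B.

Definition gkernel {R : realType} {p : nat} (tau : R) (u : 'rV[R]_p) : R :=
  expR (- ((u *m u^T) 0 0) / (2 * tau ^+ 2)).

(* Gaussian blurring mean shift on the first n points y 0, ..., y (n-1):
   gbms tau n y t i = x_{i,n}^{(t)} (only meaningful for i < n). *)
Fixpoint gbms {R : realType} {p : nat} (tau : R) (n : nat)
  (y : nat -> 'rV[R]_p) (t : nat) : nat -> 'rV[R]_p :=
  match t with
  | 0 => y
  | t'.+1 =>
      let z := gbms tau n y t' in
      fun i => (\sum_(j < n) gkernel tau (z i - z j))^-1 *:
               (\sum_(j < n) gkernel tau (z i - z j) *: z j)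
  end.

(* Main.v *)
(** After rotating by an orthogonal matrix that diagonalises [S] and dividing by
    [tau], the samples become [s k * w j k] with [w j] standard Gaussian and the
    kernel becomes [exp (- |u|^2 / 2)].  If the current points are [a k * w j k]
    for a vector [a], then by the law of large numbers one step of mean shift is
    close to the linear map [a k |-> a k * kappa a k] with
    [kappa a k = a k ^ 2 / (1 + a k ^ 2)], so iterating contracts all points
    geometrically.  To make this uniform over the whole sample, put
    [n = exp (r ^ 4)].  Almost surely [|w j|^2 <= 2 be ln n] for all [j < n] and
    large [n], where [be > 1] is close to [1]; the expected kernel sum at each
    sample point is then at least a positive power of [n], and a Chernoff bound
    on a polynomial grid with Borel-Cantelli makes all kernel sums accurate up
    to a relative error that is a negative power of [n].  The derivative of the
    logarithm of the kernel sum gives the mean-shift map, and one step enlarges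
    the error by a factor polynomial in [r]; over [r ^ 2] steps this is
    [exp (O (r ^ 3))], still negligible.  So after [r ^ 2] steps all points are
    within [O (1 / r)] of the origin, and [c n] lies in their convex hull. *)
Require Import Defs.
From HB Require Import structures.
From mathcomp Require Import all_boot all_order all_algebra.
From mathcomp Require Import all_classical all_reals all_analysis.
From mathcomp Require Import measurable_realfun complex ring lra.
Import Order.TTheory GRing.Theory Num.Theory.
Import numFieldNormedType.Exports.
Local Open Scope classical_set_scope.
Local Open Scope ring_scope.
Set Implicit Arguments. Unset Strict Implicit. Unset Printing Implicit Defensive.

(** * Change of variables against a density *)

(** Two obstacles shape the proof. A sample point is random and is itself a term of its kernel sum,
    so concentration is claimed only at deterministic points; a nearby grid point stands in for the
    sample, at a cost polynomial in [r]. And the Gaussian hypothesis gives only the laws of linear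
    combinations, so Gaussian kernels are rewritten as averages of cosines or exponentials of linear
    forms.

    The exponents: let [bs] bound the scales [s k] and [rho = bs ^ 2 / (1 + bs ^ 2)]. Where
    [|w|^2 <= 2 be ln n], the mean of the kernel sum is at least a constant times
    [n ^ (1 - rho * be)]. As [rho < 1], some [be > 1] keeps [16 * b = 1 - rho * be] positive. Half
    of it absorbs constants and leaves [n ^ (8 b)]; a relative error [del = n ^ (- 2 b)] costs
    [del ^ 2], and a failure probability of order [exp (- n ^ (4 b) / 4)] beats any polynomial
    number of tests. Log-convexity turns the values at offsets [0], [h], [- h] into a derivative,
    with error of order [h + del / h] up to powers of [r], whence [h = n ^ (- b)]. The fourth root
    [r] of [ln n] makes radius and number of steps both of order [r ^ 2]. *)

Section density.
Local Open Scope ereal_scope.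
Context d d' (T : measurableType d) (T' : measurableType d') (R : realType).
Variables (mu : {measure set T -> \bar R}) (nu : {measure set T' -> \bar R}).
Variables (phi : T -> T') (g : T -> R).
Hypotheses (mphi : measurable_fun setT phi) (g0 : forall x, (0 <= g x)%R).
Hypothesis mg : measurable_fun setT g.
Hypothesis nuE : forall A, measurable A ->
  nu A = \int[mu]_x ((\1_A (phi x))%:E * (g x)%:E).

Import HBNNSimple.

(** [nuE] says that [nu] is the image under [phi] of the measure with density [g]; simple functions
    and monotone convergence carry this to integrals. It serves for normal densities ([phi] the
    identity), for image laws ([g = 1]), and for a weighted measure on a smaller sigma-algebra in
    the treatment of independence. *)
Lemma ge0_integral_comp_density (f : T' -> \bar R) :
  (forall x, 0 <= f x) -> measurable_fun setT f ->
  \int[nu]_x f x = \int[mu]_x (f (phi x) * (g x)%:E).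
Proof.
move=> f0 mf; pose h := nnsfun_approx measurableT mf.
have cvh x : EFin \o h^~ x @ \oo --> f x by exact: cvg_nnsfun_approx.
have -> : \int[nu]_x f x = lim (\int[nu]_x (EFin \o h n) x @[n --> \oo]).
  rewrite -monotone_convergence//.
  - by apply: eq_integral => x _; apply/esym/cvg_lim => //; exact: cvh.
  - by move=> n; apply/measurable_EFinP.
  - by move=> n x _ /=; rewrite lee_fin.
  - by move=> x _ a b ab; rewrite lee_fin; exact/lefP/nd_nnsfun_approx.
have mhp n : measurable_fun setT (h n \o phi).
  exact: measurableT_comp.
have -> : \int[mu]_x (f (phi x) * (g x)%:E) =
    lim (\int[mu]_x ((h n (phi x))%:E * (g x)%:E) @[n --> \oo]).
  rewrite -monotone_convergence//.
  - apply: eq_integral => x _; apply/esym/cvg_lim => //.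
    by apply: cvgeZr => //; exact: cvh.
  - move=> n; apply: emeasurable_funM; apply/measurable_EFinP => //.
    exact: mhp.
  - by move=> n x _; rewrite mule_ge0// lee_fin.
  - move=> x _ a b ab; rewrite lee_wpmul2r ?lee_fin//.
    exact/lefP/nd_nnsfun_approx.
suff suf n : \int[mu]_x ((h n (phi x))%:E * (g x)%:E) = \int[nu]_x (EFin \o h n) x.
  by congr (lim (_ @ \oo)); apply/funext => n; rewrite suf.
have indic_ge0 y x : 0 <= (y * \1_(h n @^-1` [set y]) x)%:E.
  exact: nnfun_muleindic_ge0.
transitivity (\int[nu]_x
   (\sum_(y \in range (h n)) (y * \1_(h n @^-1` [set y]) x)%:E)); last first.
  by apply: eq_integral => t tE; rewrite /= fimfunE -fsumEFin.
have mind r : measurable_fun setT (fun x => (r * \1_(h n @^-1` [set r]) x)%:E).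
  by apply/measurable_EFinP; exact: measurable_funM.
rewrite ge0_integral_fsum//.
transitivity (\int[mu]_x (\sum_(y \in range (h n))
    (y * \1_(h n @^-1` [set y]) (phi x))%:E * (g x)%:E)).
  apply: eq_integral => x _.
  rewrite -ge0_mule_fsuml => [|y]; last exact: indic_ge0.
  by rewrite fsumEFin // -(fimfunE _ (phi x)).
have mindp r : measurable_fun setT (fun x => (r * \1_(h n @^-1` [set r]) (phi x))%:E).
  exact: (measurableT_comp (mind r)).
rewrite ge0_integral_fsum//; last 2 first.
  - by move=> y; apply: emeasurable_funM => //; apply/measurable_EFinP.
  - by move=> m y Ey; rewrite mule_ge0 ?lee_fin// -lee_fin.
apply: eq_fsbigr => r /[!inE] -[x0 _ rx0].
have r0 : (0 <= r)%R by rewrite -rx0.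
under [RHS]eq_integral do rewrite EFinM.
under eq_integral do rewrite EFinM -muleA.
have m1 : measurable_fun setT
    (fun x => (\1_(h n @^-1` [set r]) (phi x))%:E * (g x)%:E).
  apply: emeasurable_funM; apply/measurable_EFinP => //.
  have mi : measurable_fun setT (\1_(h n @^-1` [set r]) : T' -> R) by [].
  exact: (measurableT_comp mi mphi).
have m2 : measurable_fun setT (fun x => (\1_(h n @^-1` [set r]) x : R)%:E).
  by apply/measurable_EFinP.
have p1 x : setT x -> 0 <= (\1_(h n @^-1` [set r]) (phi x))%:E * (g x)%:E.
  by move=> _; rewrite mule_ge0// lee_fin.
have p2 x : setT x -> 0 <= (\1_(h n @^-1` [set r]) x : R)%:E.
  by move=> _; rewrite lee_fin.
rewrite [LHS](ge0_integralZl_EFin _ _ p1 m1)// [RHS](ge0_integralZl_EFin _ _ p2 m2)//.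
by rewrite integral_indic// setIT nuE.
Qed.

Lemma integral_comp_density (f : T' -> \bar R) :
  measurable_fun setT f ->
  \int[nu]_x f x = \int[mu]_x (f (phi x) * (g x)%:E).
Proof.
move=> mf; rewrite integralE [RHS]integralE; congr (_ - _).
  rewrite ge0_integral_comp_density//; last exact: measurable_funepos.
  apply: eq_integral => x _; rewrite !funeposE.
by rewrite !(muleC _ (g x)%:E) maxe_pMr ?mule0 ?lee_fin.
rewrite ge0_integral_comp_density//; last exact: measurable_funeneg.
apply: eq_integral => x _; rewrite !funenegE.
by rewrite !(muleC _ (g x)%:E) -muleN maxe_pMr ?mule0 ?lee_fin.
Qed.

End density.

(** * The normal law on the line *)

Section normal.
Context {R : realType}.
Local Notation lam := (@lebesgue_measure R).
Implicit Types s u c x : R.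

Lemma normal_pdf0E s x : 0 < s ->
  normal_pdf 0 s x = normal_peak s * expR (- (x ^+ 2 / (s ^+ 2 * 2))).
Proof.
move=> s0; rewrite normal_pdfE ?gt_eqF// /normal_fun subr0.
by rewrite mulNr -mulr_natr.
Qed.

Lemma integral_normal_probE s (f : R -> \bar R) : 0 < s ->
  measurable_fun setT f ->
  (\int[normal_prob 0 s]_x f x = \int[lam]_x (f x * (normal_pdf 0 s x)%:E))%E.
Proof.
move=> s0 mf.
rewrite (@integral_comp_density _ _ _ _ _ lam _ idfun (normal_pdf 0 s))//.
- exact: measurable_id.
- by move=> x; exact: normal_pdf_ge0.
- exact: measurable_normal_pdf.
- move=> A mA; rewrite [LHS]integral_mkcond epatch_indic.
  by under eq_integral do rewrite muleC.
Qed.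

(** Completing the square: an exponential tilt moves the mean from [0] to [u * s ^ 2]. *)
Lemma expR_mul_normal_pdf s u x : 0 < s ->
  expR (u * x) * normal_pdf 0 s x =
  expR (u ^+ 2 * s ^+ 2 / 2) * normal_pdf (u * s ^+ 2) s x.
Proof.
move=> s0; rewrite normal_pdf0E// normal_pdfE ?gt_eqF// /normal_fun.
rewrite mulrCA [RHS]mulrCA -!expRD; congr (_ * expR _).
by field; rewrite gt_eqF.
Qed.

Lemma normal_mgf s u : 0 < s ->
  (\int[normal_prob 0 s]_x (expR (u * x))%:E = (expR (u ^+ 2 * s ^+ 2 / 2))%:E)%E.
Proof.
move=> s0; rewrite integral_normal_probE//; last first.
  by apply/measurable_EFinP; apply: measurableT_comp => //; exact: mulrl_measurable.
under eq_integral do rewrite -EFinM expR_mul_normal_pdf// EFinM.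
rewrite ge0_integralZl_EFin//.
- by rewrite integral_normal_pdf mule1.
- by move=> x _; rewrite lee_fin normal_pdf_ge0.
- by apply/measurable_EFinP; exact: measurable_normal_pdf.
Qed.

(** A quadratic tilt only rescales the variance. Negative [c] is allowed, and is the case behind the
    exponential moments of squares. *)
Lemma expRsq_mul_normal_pdf s c x : 0 < s -> 0 < 1 + c * s ^+ 2 ->
  expR (- (c * x ^+ 2) / 2) * normal_pdf 0 s x =
  (Num.sqrt (1 + c * s ^+ 2))^-1 *
  normal_pdf 0 (s / Num.sqrt (1 + c * s ^+ 2)) x.
Proof.
move=> s0 c0; have q0 : 0 < Num.sqrt (1 + c * s ^+ 2) by rewrite sqrtr_gt0.
rewrite !normal_pdf0E ?divr_gt0// mulrCA [RHS]mulrA; congr (_ * _); last first.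
  rewrite -expRD exprMn exprVn sqr_sqrtr ?ltW//; congr expR.
  by field; rewrite !gt_eqF.
rewrite /normal_peak -invfM -sqrtrM ?ltW//; congr (Num.sqrt _)^-1.
rewrite -[_ *+ 2]mulr_natr -[in RHS](mulr_natr _ 2) exprMn exprVn sqr_sqrtr ?ltW//.
by field; rewrite gt_eqF.
Qed.

Lemma normal_integral_expRsq s c : 0 < s -> 0 < 1 + c * s ^+ 2 ->
  (\int[normal_prob 0 s]_x (expR (- (c * x ^+ 2) / 2))%:E =
   ((Num.sqrt (1 + c * s ^+ 2))^-1)%:E)%E.
Proof.
move=> s0 c0; rewrite integral_normal_probE//; last first.
  apply/measurable_EFinP; apply: measurableT_comp => //.
  apply: measurable_funM => //; apply: measurableT_comp => //.
  by apply: measurable_funM => //; exact: measurable_funX.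
under eq_integral do rewrite -EFinM expRsq_mul_normal_pdf// EFinM.
rewrite ge0_integralZl_EFin//.
- by rewrite integral_normal_pdf mule1.
- by move=> x _; rewrite lee_fin normal_pdf_ge0.
- by apply/measurable_EFinP; exact: measurable_normal_pdf.
Qed.

(** Half of the Gaussian exponent absorbs the factor [|x|], so integrability against [x * pdf x] is
    inherited from the normal density of doubled variance. *)
Lemma normal_pdf_normX s x : 0 < s ->
  `|x| * normal_pdf 0 s x <= (2 * s) * (normal_peak s / normal_peak (Num.sqrt 2 * s))
    * normal_pdf 0 (Num.sqrt 2 * s) x.
Proof.
move=> s0; have s20 : 0 < Num.sqrt 2 * s :> R by rewrite mulr_gt0// sqrtr_gt0.
have np := normal_peak_gt0 (lt0r_neq0 s0).
have np2 := normal_peak_gt0 (lt0r_neq0 s20).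
rewrite !normal_pdf0E// exprMn sqr_sqrtr//.
set E := expR _; set F := expR _.
have -> : 2 * s * (normal_peak s / normal_peak (Num.sqrt 2 * s)) *
   (normal_peak (Num.sqrt 2 * s) * F) = normal_peak s * (2 * s * F).
  by field; rewrite gt_eqF.
rewrite mulrCA ler_pM2l// /E /F.
have -> : - (x ^+ 2 / (s ^+ 2 * 2)) =
    - (x ^+ 2 / (2 * s ^+ 2 * 2)) + - (x ^+ 2 / (2 * s ^+ 2 * 2)).
  by field; rewrite gt_eqF.
rewrite expRD [leLHS]mulrA ler_pM2r ?expR_gt0//.
rewrite expRN ler_pdivrMr ?expR_gt0//.
have h := expR_ge1Dx (x ^+ 2 / (2 * s ^+ 2 * 2)).
apply: (@le_trans _ _ (2 * s * (1 + x ^+ 2 / (2 * s ^+ 2 * 2)))); last first.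
  by rewrite ler_pM2l ?mulr_gt0.
have xE : x ^+ 2 = `|x| ^+ 2 by rewrite real_normK ?num_real.
have -> : 2 * s * (1 + x ^+ 2 / (2 * s ^+ 2 * 2)) =
    `|x| + (s + (s - `|x|/2)^+2 / s + `|x| ^+ 2 / (4 * s)).
  by rewrite xE; field; rewrite gt_eqF.
rewrite lerDl; apply: addr_ge0.
  apply: addr_ge0; first exact: ltW.
  by apply: mulr_ge0; [exact: sqr_ge0|rewrite invr_ge0 ltW].
by apply: mulr_ge0; [exact: sqr_ge0|rewrite invr_ge0 mulr_ge0// ltW].
Qed.
End normal.

(** * Characteristic function of a centred normal law *)

Section charfn.
Context {R : realType}.
Local Notation lam := (@lebesgue_measure R).
Variable s : R.
Hypothesis s0 : 0 < s.
Local Notation pdf := (normal_pdf 0 s).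

Let mpdf : measurable_fun setT pdf. Proof. exact: measurable_normal_pdf. Qed.

Let intpdfM (h : R -> R) : measurable_fun setT h -> (forall x, `|h x| <= 1) ->
  lam.-integrable setT (EFin \o (fun x => h x * pdf x)).
Proof.
move=> mh h1; apply: (le_integrable _ _ _ (integrable_normal_pdf 0 s)) => //.
  by apply/measurable_EFinP; exact: measurable_funM.
move=> x _; rewrite /= lee_fin normrM ler_piMl//.
Qed.

Let intpdfX (h : R -> R) : measurable_fun setT h -> (forall x, `|h x| <= 1) ->
  lam.-integrable setT (EFin \o (fun x => x * h x * pdf x)).
Proof.
move=> mh h1.
have := integrableZl measurableT (2 * s * (normal_peak s / normal_peak (Num.sqrt 2 * s)))
  (integrable_normal_pdf 0 (Num.sqrt 2 * s)).
apply: le_integrable => //.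
  by apply/measurable_EFinP; do 2?[apply: measurable_funM => //].
move=> x _; rewrite /= lee_fin !normrM.
apply: (@le_trans _ _ (`|x| * pdf x)).
  rewrite (ger0_norm (normal_pdf_ge0 _ _ _)) ler_wpM2r ?normal_pdf_ge0//.
  by rewrite ler_piMr.
apply: (le_trans (normal_pdf_normX x s0)); rewrite -!normrM.
by rewrite ler_norm.
Qed.

Lemma is_derive_normal_pdf x : is_derive x (1 : R) pdf (- x / s ^+ 2 * pdf x).
Proof.
have -> : pdf = (fun x => normal_peak s * expR (- (x ^+ 2 / (s ^+ 2 * 2)))).
  by apply/funext => y; rewrite normal_pdf0E.
apply: is_derive_eq; rewrite /GRing.scale /=.
by field; rewrite gt_eqF.
Qed.

Lemma normal_pdf_cvg0 : pdf n%:R @[n --> \oo] --> 0.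
Proof.
apply/cvgrPdist_le => /= e e0.
have np := normal_peak_gt0 (lt0r_neq0 s0).
near=> n.
rewrite sub0r normrN ger0_norm ?normal_pdf_ge0// normal_pdf0E//.
rewrite -ler_pdivlMl// expRN invf_ple ?posrE ?expR_gt0//; last first.
  by apply: mulr_gt0 => //; rewrite invr_gt0.
apply: le_trans (expR_ge1Dx _).
have n1 : 1 <= n%:R :> R by rewrite ler1n; near: n; exact: nbhs_infty_gt.
apply: (@le_trans _ _ (n%:R / (s ^+ 2 * 2))).
  rewrite ler_pdivlMr ?mulr_gt0 ?exprn_gt0//.
  by near: n; exact: nbhs_infty_ger.
rewrite (@le_trans _ _ (n%:R ^+ 2 / (s ^+ 2 * 2)))// ?lerDr//.
by rewrite ler_pM2r ?invr_gt0 ?mulr_gt0 ?exprn_gt0// expr2 ler_peMl.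
Unshelve. all: by end_near. Qed.

(* The integrand is the derivative of [- s ^ 2 * sin (k * x + c) * pdf x]; the
   identity is the differential equation of the characteristic function in [k]. *)
Lemma integral_derive_normal (k c : R) :
  \int[lam]_x (x * sin (k * x + c) * pdf x - k * s ^+ 2 * (cos (k * x + c) * pdf x)) = 0.
Proof.
set g := (X in Rintegral _ _ X).
pose G x := - s ^+ 2 * (sin (k * x + c) * pdf x).
have dG x : is_derive x (1 : R) G (g x).
  have ? := is_derive_normal_pdf x.
  apply: is_derive_eq; rewrite /GRing.scale /= /g.
  by field; rewrite gt_eqF.
have msin : measurable_fun setT (fun x : R => sin (k * x + c)).
  apply: measurableT_comp; first by apply: continuous_measurable_fun; exact: continuous_sin.
  by apply: measurable_funD => //; exact: measurable_funM.
have mcos : measurable_fun setT (fun x : R => cos (k * x + c)).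
  apply: measurableT_comp; first by apply: continuous_measurable_fun; exact: continuous_cos.
  by apply: measurable_funD => //; exact: measurable_funM.
have intg : lam.-integrable setT (EFin \o g).
  have i1 : lam.-integrable setT (EFin \o (fun x => x * sin (k * x + c) * pdf x)).
    by apply: intpdfX => // x; rewrite ler_norml sin_geN1 sin_le1.
  have i2 : lam.-integrable setT (EFin \o (fun x => cos (k * x + c) * pdf x)).
    by apply: intpdfM => // x; rewrite ler_norml cos_geN1 cos_le1.
  exact: (integrableB measurableT i1 (integrableZl measurableT (k * s ^+ 2) i2)).
have cg : continuous g.
  move=> x; apply/differentiable_continuous/derivable1_diffP.
  have ? := is_derive_normal_pdf x.
  by apply: ex_derive.
have mg : measurable_fun setT g by exact: continuous_measurable_fun.
have FTC n : (\int[lam]_(x in `[(- n.+1%:R)%R, n.+1%:R]) (g x)%:E = (G n.+1%:R)%:E - (G (- n.+1%:R))%:E)%E.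
  apply: (continuous_FTC2 (F := G)) => //.
  - by rewrite gtrN.
  - exact: continuous_subspaceT.
  - split.
    + by move=> x _; apply: ex_derive; exact: dG.
    + apply: cvg_at_right_filter; apply/differentiable_continuous/derivable1_diffP.
      by apply: ex_derive; exact: dG.
    + apply: cvg_at_left_filter; apply/differentiable_continuous/derivable1_diffP.
      by apply: ex_derive; exact: dG.
  - by move=> x _; rewrite derive1E; apply: derive_val; exact: dG.
have cvI : (\int[lam]_x ((g \_ `[(- n.+1%:R)%R, n.+1%:R]) x)%:E @[n --> \oo] -->
    \int[lam]_x (g x)%:E)%E.
  have := @dominated_convergence _ _ _ lam setT measurableT
    (fun n x => ((g \_ `[(- n.+1%:R)%R, n.+1%:R]) x)%:E) (EFin \o g)
    (fun x => `|g x|%:E).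
  case=> //.
  - move=> n; apply/measurable_EFinP/(measurable_restrictT _ _).1 => //.
    exact: measurable_funTS.
  - by apply/measurable_EFinP.
  - apply: aeW => x _; apply: cvg_near_cst.
    near=> n; rewrite /patch mem_set// /= in_itv/= -ler_norml.
    by apply: (@le_trans _ _ n%:R); [near: n; exact: nbhs_infty_ger|rewrite ler_nat].
  - exact: integrable_norm.
  - apply: aeW => x n _ /=; rewrite lee_fin /patch; case: ifPn => // _.
    by rewrite normr0.
have cvG : ((G n.+1%:R)%:E - (G (- n.+1%:R))%:E @[n --> \oo] --> (0%:E : \bar R))%E.
  rewrite (_ : (fun n => _) = (fun n => (- (2 * s ^+ 2) *
    ((sin (k * n.+1%:R + c) - sin (k * - n.+1%:R + c)) / 2 * pdf n.+1%:R))%:E)); last first.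
    apply/funext => n; rewrite -EFinB /G; congr EFin.
    by rewrite !normal_pdf0E// sqrrN; field.
  apply/cvg_EFin; first by apply: nearW.
  rewrite -[X in _ --> X](mulr0 (- (2 * s ^+ 2))); apply: cvgMl_tmp.
  apply/norm_cvg0P; apply: (@squeeze_cvgr _ _ _ _ (cst 0) (fun n => pdf n.+1%:R)).
  - apply: nearW => n /=; rewrite normr_ge0 normrM.
    rewrite (ger0_norm (normal_pdf_ge0 _ _ _)) ler_piMl ?normal_pdf_ge0//.
    have := sin_geN1 (k * n.+1%:R + c); have := sin_le1 (k * n.+1%:R + c).
    have := sin_geN1 (k * - n.+1%:R + c); have := sin_le1 (k * - n.+1%:R + c).
    by rewrite ler_norml => *; apply/andP; split; lra.
  - exact: cvg_cst.
  - by have := normal_pdf_cvg0; rewrite -(cvg_shiftS (fun n => pdf n%:R)).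
rewrite /Rintegral; suff -> : (\int[lam]_x (g x)%:E = 0)%E by [].
apply: cvg_unique cvI _ => //.
rewrite (_ : (fun n => _) = (fun n => ((G n.+1%:R)%:E - (G (- n.+1%:R))%:E)%E))//.
apply/funext => n; rewrite -FTC [RHS]integral_mkcond.
by apply: eq_integral => x _; rewrite /patch; case: ifPn.
Unshelve. all: by end_near. Qed.

(** Differentiation under the integral sign and [integral_derive_normal] give
    [phi' k = - k * s ^ 2 * phi k], so [phi k * exp (k ^ 2 * s ^ 2 / 2)] is constant. The phase [c]
    does the work of complex values. *)
Lemma normal_charfun_pdf (k c : R) :
  \int[lam]_x (cos (k * x + c) * pdf x) = expR (- (k ^+ 2 * s ^+ 2 / 2)) * cos c.
Proof.
pose phi k := \int[lam]_x (cos (k * x + c) * pdf x).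
have msin k' : measurable_fun setT (fun x : R => sin (k' * x + c)).
  apply: measurableT_comp; first by apply: continuous_measurable_fun; exact: continuous_sin.
  by apply: measurable_funD => //; exact: measurable_funM.
have mcos k' : measurable_fun setT (fun x : R => cos (k' * x + c)).
  apply: measurableT_comp; first by apply: continuous_measurable_fun; exact: continuous_cos.
  by apply: measurable_funD => //; exact: measurable_funM.
have intc k' : lam.-integrable setT (EFin \o (fun x => cos (k' * x + c) * pdf x)).
  by apply: intpdfM => // x; rewrite ler_norml cos_geN1 cos_le1.
have ints k' : lam.-integrable setT (EFin \o (fun x => x * sin (k' * x + c) * pdf x)).
  by apply: intpdfX => // x; rewrite ler_norml sin_geN1 sin_le1.
have dc x k' : is_derive k' (1 : R) (fun k => cos (k * x + c) * pdf x) (- (x * sin (k' * x + c) * pdf x)).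
  by apply: is_derive_eq; rewrite /GRing.scale /=; ring.
pose B x := `|x| * pdf x.
have intB : lam.-integrable setT (EFin \o B).
  have := integrable_norm (intpdfX (h := cst 1) (measurable_cst _) _).
  rewrite [X in _ -> integrable _ _ X](_ : _ = EFin \o (fun x => `|x * cst 1 x * pdf x|)).
    by apply=> x; rewrite normr1.
  apply/funext => x; rewrite /= mulr1 normrM.
  by rewrite (ger0_norm (normal_pdf_ge0 _ _ _)).
have dphi k' : is_derive k' (1 : R) phi (- (k' * s ^+ 2) * phi k').
  have k'I : `](k' - 1), (k' + 1)[%classic k' by rewrite /= in_itv/=; apply/andP; split; lra.
  have d1 (x y : R) : `](k' - 1), (k' + 1)[%classic x -> setT y ->
      derivable (fun k : R => cos (k * y + c) * pdf y) x (1 : R) by move=> _ _; apply: ex_derive; exact: dc.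
  have G0 x : 0 <= B x by rewrite mulr_ge0 ?normal_pdf_ge0.
  have ub x y : `](k' - 1), (k' + 1)[%classic x -> setT y ->
      `|partial1of2 (fun k x => cos (k * x + c) * pdf x) x y| <= B y.
    move=> _ _; rewrite partial1of2E (@derive_val _ _ _ _ _ _ _ (dc y x)).
    rewrite normrN !normrM (ger0_norm (normal_pdf_ge0 _ _ _)) /B ler_wpM2r ?normal_pdf_ge0//.
    by rewrite ler_piMr// ler_norml sin_geN1 sin_le1.
  have drv := derivable_under_integral measurableT k'I (fun x _ => intc x) d1 G0 intB ub.
  have := differentiation_under_integral measurableT k'I (fun x _ => intc x) d1 G0 intB ub.
  rewrite derive1E => drve; apply: DeriveDef; first exact: drv.
  rewrite drve.
  under eq_Rintegral do rewrite partial1of2E (@derive_val _ _ _ _ _ _ _ (dc _ _)).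
  have := integral_derive_normal k' c.
  rewrite RintegralB//; last exact: (integrableZl measurableT (k' * s ^+ 2) (intc k')).
  rewrite RintegralZl// => /eqP; rewrite subr_eq0 => /eqP h.
  under eq_Rintegral do rewrite -mulN1r.
  by rewrite RintegralZl// h /phi; ring.
have := @is_derive_0_is_cst R (fun k => phi k * expR (k ^+ 2 * s ^+ 2 / 2)) k 0.
have h0 x : is_derive x (1 : R) (fun k => phi k * expR (k ^+ 2 * s ^+ 2 / 2)) 0.
  by have ? := dphi x; apply: is_derive_eq; rewrite /GRing.scale /=; field.
move=> /(_ h0); rewrite -/(phi k).
have -> : phi 0 = cos c.
  rewrite /phi; under eq_Rintegral do rewrite mul0r add0r.
  rewrite RintegralZl//; last exact: integrable_normal_pdf.
  by rewrite /Rintegral integral_normal_pdf mulr1.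
rewrite expr0n/= !mul0r expR0 mulr1 => h.
by rewrite expRN mulrC -h mulfK ?gt_eqF ?expR_gt0.
Qed.

Lemma normal_charfun (k c : R) :
  (\int[normal_prob 0 s]_x (cos (k * x + c))%:E =
   (expR (- (k ^+ 2 * s ^+ 2 / 2)) * cos c)%:E)%E.
Proof.
have mcos : measurable_fun setT (fun x : R => cos (k * x + c)).
  apply: measurableT_comp; first by apply: continuous_measurable_fun; exact: continuous_cos.
  by apply: measurable_funD => //; exact: measurable_funM.
rewrite integral_normal_probE//; last exact/measurable_EFinP.
have i : lam.-integrable setT (EFin \o (fun x => cos (k * x + c) * pdf x)).
  by apply: intpdfM => // x; rewrite ler_norml cos_geN1 cos_le1.
rewrite -normal_charfun_pdf /Rintegral fineK//.
exact: integrable_fin_num.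
Qed.
End charfn.

(** * Standard Gaussian vectors *)

Section fourier.
Context {R : realType}.

Lemma cos_mul (x y : R) : cos x * cos y = 2^-1 * (cos (x + y) + cos (x - y)).
Proof. by rewrite cosB cosD; field. Qed.

(** The Gaussian is its own Fourier transform; [u] acts as a random frequency, made independent of
    the sample by a product measure. *)
Lemma expRsq_cos_mix (x : R) :
  (\int[normal_prob 0 1]_u (cos (u * x))%:E = (expR (- (x ^+ 2) / 2))%:E)%E.
Proof.
have := normal_charfun (@ltr01 R) x 0.
rewrite cos0 mulr1 expr1n mulr1 mulNr => <-.
by apply: eq_integral => u _; rewrite addr0 mulrC.
Qed.

(** Hubbard-Stratonovich linearisation: the exponential of a square is an average of exponentials of
    linear terms. *)
Lemma expRsq_expR_mix (c x : R) : 0 <= c ->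
  (\int[normal_prob 0 1]_u (expR (Num.sqrt c * x * u))%:E = (expR (c * x ^+ 2 / 2))%:E)%E.
Proof.
move=> c0; rewrite normal_mgf//; congr (expR _)%:E.
by rewrite exprMn sqr_sqrtr// expr1n mulr1.
Qed.

(** The quadratic factor turns the standard normal law into one of variance [1 / (1 + b ^ 2)], whose
    characteristic function is taken at [c]. This integrates out the random frequency of
    [expRsq_cos_mix]. *)
Lemma normal_expRsq_cos (b c : R) :
  (\int[normal_prob 0 1]_u (expR (- (b ^+ 2 * u ^+ 2) / 2) * cos (u * c))%:E =
   ((Num.sqrt (1 + b ^+ 2))^-1 * expR (- (c ^+ 2) / (2 * (1 + b ^+ 2))))%:E)%E.
Proof.
have b0 : 0 < 1 + b ^+ 2 by rewrite ltr_pwDl// sqr_ge0.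
have b1 : 0 < 1 + b ^+ 2 * 1 ^+ 2 by rewrite expr1n mulr1.
have q0 : 0 < Num.sqrt (1 + b ^+ 2) by rewrite sqrtr_gt0.
have mc : measurable_fun setT (fun u : R => cos (u * c)).
  apply: measurableT_comp; first by apply: continuous_measurable_fun; exact: continuous_cos.
  exact: measurable_funM.
have me : measurable_fun setT (fun u : R => expR (- (b ^+ 2 * u ^+ 2) / 2)).
  apply: measurableT_comp => //; apply: measurable_funM => //.
  apply: measurableT_comp => //; apply: measurable_funM => //; exact: measurable_funX.
rewrite integral_normal_probE//; last first.
  by apply/measurable_EFinP; exact: measurable_funM.
have s0 : 0 < 1 / Num.sqrt (1 + b ^+ 2 * 1 ^+ 2) :> R.
  by rewrite divr_gt0// sqrtr_gt0.
have mc' : measurable_fun setT (fun u : R => (cos (c * u + 0))%:E).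
  apply/measurable_EFinP; apply: eq_measurable_fun mc => u _.
  by rewrite addr0 mulrC.
have := normal_charfun s0 c 0.
rewrite integral_normal_probE// => h.
transitivity (((Num.sqrt (1 + b ^+ 2))^-1)%:E *
   \int[lebesgue_measure]_u ((cos (c * u + 0))%:E * (normal_pdf 0 (1 / Num.sqrt (1 + b ^+ 2 * 1 ^+ 2)) u)%:E))%E; last first.
  rewrite h -EFinM cos0 mulr1; congr (_ * expR _)%:E.
  rewrite expr_div_n expr1n mulr1 sqr_sqrtr ?ltW//.
  by field; rewrite gt_eqF.
rewrite -integralZl//; last first.
  apply/integrableP; split.
    by apply: emeasurable_funM => //; apply/measurable_EFinP; exact: measurable_normal_pdf.
  have := integrable_normal_pdf 0 (1 / Num.sqrt (1 + b ^+ 2 * 1 ^+ 2)).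
  move=> /integrableP[_]; apply: le_lt_trans; apply: ge0_le_integral => //.
  - apply: measurableT_comp => //; apply: emeasurable_funM => //.
    by apply/measurable_EFinP; exact: measurable_normal_pdf.
  - by apply: measurableT_comp => //; apply/measurable_EFinP; exact: measurable_normal_pdf.
  - move=> u _; rewrite -EFinM /= lee_fin normrM ler_piMl//.
    by rewrite ler_norml cos_geN1 cos_le1.
apply: eq_integral => u _; rewrite -!EFinM; congr EFin.
rewrite mulrAC expRsq_mul_normal_pdf// expr1n mulr1 addr0 (mulrC c).
by rewrite -mulrA (mulrC (cos _)).
Qed.

End fourier.

Lemma bounded_normP (T : Type) (R : realType) (f : T -> R) (M : R) (A : set T) :
  (forall x, `|f x| <= M) -> [bounded f x | x in A].
Proof.
move=> fM; exists M; split; first exact: num_real.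
by move=> N MN x _; exact: le_trans (fM x) (ltW MN).
Qed.

Lemma bounded_integrable_probability d (T : measurableType d) (R : realType)
  (P : probability T R) (f : T -> R) (M : R) :
  measurable_fun setT f -> (forall x, `|f x| <= M) -> P.-integrable setT (EFin \o f).
Proof.
move=> mf fM; apply: measurable_bounded_integrable => //.
  by rewrite (le_lt_trans (probability_le1 _ _))// ltry.
exact: bounded_normP fM.
Qed.

(** * Kernel averages and exponential moments from linear combinations alone *)

Section gaussian.
Context d (Omega : measurableType d) (R : realType) (P : probability Omega R).
Variables (p : nat) (W : Omega -> 'I_p -> R).
Hypothesis mW : forall k, measurable_fun setT (W ^~ k).
Hypothesis gW : forall a : 'I_p -> R, 0 < \sum_k a k ^+ 2 ->
  forall B : set R, measurable B ->
  P [set w | B (\sum_k a k * W w k)] = normal_prob 0 (Num.sqrt (\sum_k a k ^+ 2)) B.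

Let msum a : measurable_fun setT (fun w => \sum_k a k * W w k).
Proof. by apply: measurable_sum => k; exact: measurable_funM. Qed.

Lemma integral_gaussian_lin a (f : R -> \bar R) : 0 < \sum_k a k ^+ 2 ->
  measurable_fun setT f ->
  (\int[P]_w f (\sum_k a k * W w k)%R =
   \int[normal_prob 0 (Num.sqrt (\sum_k a k ^+ 2))]_x f x)%E.
Proof.
move=> a0 mf; apply/esym.
apply: etrans (@integral_comp_density _ _ Omega _ R P
  (normal_prob 0 (Num.sqrt (\sum_k a k ^+ 2))) (fun w => \sum_k a k * W w k)
  (cst 1) (msum a) _ _ _ f mf) _ => //.
- move=> A mA; apply: etrans (esym (gW a0 mA)) _.
  rewrite [in LHS](_ : [set w | _] = (fun w => \sum_k a k * W w k) @^-1` A)//.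
  rewrite -[X in P X = _]setIT -integral_indic//.
    by apply: eq_integral => x _; rewrite mule1.
  by rewrite -[X in measurable X]setTI; exact: msum.
- by apply: eq_integral => x _; rewrite mule1.
Qed.

Let sum0_eq0 (a : 'I_p -> R) : ~~ (0 < \sum_k a k ^+ 2) -> forall k, a k = 0.
Proof.
rewrite -leNgt => h k.
have : \sum_k a k ^+ 2 == 0 by rewrite eq_le h sumr_ge0// => i _; rewrite sqr_ge0.
rewrite psumr_eq0; last by move=> i _; rewrite sqr_ge0.
by move=> /allP/(_ k); rewrite mem_index_enum => /(_ isT)/=; rewrite sqrf_eq0 => /eqP.
Qed.

Lemma gaussian_charfun a c :
  (\int[P]_w (cos (\sum_k a k * W w k + c))%:E =
   (expR (- (\sum_k a k ^+ 2) / 2) * cos c)%:E)%E.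
Proof.
have [a0|/sum0_eq0 a0] := boolP (0 < \sum_k a k ^+ 2).
  rewrite (integral_gaussian_lin (f := fun x => (cos (x + c))%:E))//; last first.
    apply/measurable_EFinP; apply: measurableT_comp.
      by apply: continuous_measurable_fun; exact: continuous_cos.
    exact: measurable_funD.
  have s0 : 0 < Num.sqrt (\sum_k a k ^+ 2) by rewrite sqrtr_gt0.
  have := normal_charfun s0 1 c.
  rewrite sqr_sqrtr ?ltW// expr1n mul1r mulNr => <-.
  by apply: eq_integral => x _; rewrite mul1r.
rewrite [in RHS]big1 ?oppr0 ?mul0r ?expR0 ?mul1r; last by move=> k _; rewrite a0 expr0n.
rewrite (eq_integral (cst (cos c)%:E)); last first.
  by move=> w _; rewrite big1 ?add0r// => k _; rewrite a0 mul0r.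
by rewrite integral_cst// [X in (_ * X)%E](_ : _ = 1%E) ?mule1//; exact: probability_setT.
Qed.

Lemma gaussian_mgf a :
  (\int[P]_w (expR (\sum_k a k * W w k))%:E =
   (expR ((\sum_k a k ^+ 2) / 2))%:E)%E.
Proof.
have [a0|/sum0_eq0 a0] := boolP (0 < \sum_k a k ^+ 2).
  rewrite (integral_gaussian_lin (f := fun x => (expR x)%:E))//; last exact/measurable_EFinP.
  have s0 : 0 < Num.sqrt (\sum_k a k ^+ 2) by rewrite sqrtr_gt0.
  have := normal_mgf 1 s0.
  rewrite sqr_sqrtr ?ltW// expr1n mul1r => <-.
  by apply: eq_integral => x _; rewrite mul1r.
rewrite [in RHS]big1 ?mul0r ?expR0; last by move=> k _; rewrite a0 expr0n.
rewrite (eq_integral (cst 1%:E)); last first.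
  by move=> w _; rewrite big1 ?expR0// => k _; rewrite a0 mul0r.
by rewrite integral_cst// [X in (_ * X)%E](_ : _ = 1%E) ?mule1//; exact: probability_setT.
Qed.

Section kernel.
Variables b c : 'I_p -> R.
Let K k w := expR (- (b k * W w k - c k) ^+ 2 / 2).

Let mK k : measurable_fun setT (K k).
Proof.
apply: measurableT_comp => //; apply: measurable_funM => //.
apply: measurableT_comp => //; apply: measurable_funX.
by apply: measurable_funB => //; exact: measurable_funM.
Qed.

Let K01 k w : 0 <= K k w <= 1.
Proof.
by rewrite expR_ge0 -expR0 ler_expR mulNr oppr_le0 divr_ge0// sqr_ge0.
Qed.

Let prodK01 (s : seq 'I_p) w : 0 <= \prod_(k <- s) K k w <= 1.
Proof.
apply/andP; split; first by apply: prodr_ge0 => i _; case/andP: (K01 i w).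
by apply: prodr_ile1 => i _; exact: K01.
Qed.

Let mprodK (s : seq 'I_p) : measurable_fun setT (fun w => \prod_(k <- s) K k w).
Proof. exact: measurable_prod. Qed.

Let mcos : measurable_fun setT (@cos R).
Proof. by apply: continuous_measurable_fun; exact: continuous_cos. Qed.

Let cos_norm1 (x : R) : `|cos x| <= 1.
Proof. by rewrite ler_norml cos_geN1 cos_le1. Qed.

Let integrable_prodK s a f :
  P.-integrable setT (EFin \o (fun w => \prod_(k <- s) K k w * cos (\sum_k a k * W w k + f))).
Proof.
apply: (@bounded_integrable_probability _ _ _ _ _ 1).
- apply: measurable_funM => //; apply: measurableT_comp => //; exact: measurable_funD.
- move=> w; rewrite normrM.
  by case/andP: (prodK01 s w) => k0 k1; rewrite mulr_ile1// ger0_norm.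
Qed.

(* Each factor [K k] is an average of cosines, see [expRsq_cos_mix], so it can be
   absorbed into the cosine; this needs only the law of linear combinations and
   never the joint density of the coordinates. *)
Lemma gaussian_kernel_charfun (s : seq 'I_p) (a : 'I_p -> R) (f : R) :
  uniq s -> (forall k, k \in s -> a k = 0) ->
  (\int[P]_w (\prod_(k <- s) K k w * cos (\sum_k a k * W w k + f))%:E =
   (\prod_(k <- s) ((Num.sqrt (1 + b k ^+ 2))^-1 *
       expR (- (c k ^+ 2) / (2 * (1 + b k ^+ 2)))) *
    (expR (- (\sum_k a k ^+ 2) / 2) * cos f))%:E)%E.
Proof.
elim: s a f => [|k s IH] a f.
  move=> _ _; rewrite big_nil mul1r -gaussian_charfun.
  by apply: eq_integral => w _; rewrite big_nil mul1r.
move=> /= /andP[ks us] a0.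
pose N := @normal_prob R 0 1.
pose F (z : Omega * R) : R := \prod_(j <- s) K j z.1 * cos (\sum_j a j * W z.1 j + f) *
  cos (z.2 * (b k * W z.1 k - c k)).
have mF : measurable_fun setT F.
  apply: measurable_funM; first apply: measurable_funM.
  - apply: (measurableT_comp (f := fun w => \prod_(j <- s) K j w)) measurable_fst.
    exact: measurable_prod.
  - apply: (measurableT_comp (f := fun w => cos (\sum_j a j * W w j + f))) measurable_fst.
    by apply: measurableT_comp => //; exact: measurable_funD.
  - apply: measurableT_comp => //; apply: measurable_funM => //.
    apply: (measurableT_comp (f := fun w => b k * W w k - c k)) measurable_fst.
    by apply: measurable_funB => //; exact: measurable_funM.
have iF : (P \x N)%E.-integrable setT (EFin \o F).
  apply: measurable_bounded_integrable => //.
  - rewrite -setXTT; apply: (@le_lt_trans _ _ (P setT * N setT)%E); last first.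
      by rewrite /N !probability_setT mule1 ltry.
    have E := @product_measure1E _ _ _ _ R P (@normal_prob R 0 1) setT setT measurableT measurableT.
    by rewrite le_eqVlt; apply/orP; left; apply/eqP; exact: E.
  - apply: (@bounded_normP _ _ _ 1) => w; rewrite !normrM.
    case/andP: (prodK01 s w.1) => k0 k1.
    by rewrite mulr_ile1// mulr_ile1// ger0_norm.
transitivity (\int[P]_w \int[N]_u (F (w, u))%:E)%E.
  apply: eq_integral => w _; rewrite /F/=.
  under [RHS]eq_integral do rewrite EFinM.
  rewrite integralZl//; last first.
    apply: (@bounded_integrable_probability _ _ _ _ _ 1) => //.
    by apply: measurableT_comp => //; exact: measurable_funM.
  by rewrite expRsq_cos_mix -EFinM big_cons /K; congr EFin; ring.
rewrite (Fubini iF) /=.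
have half u : (\int[P]_w (F (w, u))%:E = (\prod_(k <- s) ((Num.sqrt (1 + b k ^+ 2))^-1 *
       expR (- (c k ^+ 2) / (2 * (1 + b k ^+ 2)))) * (expR (- (\sum_k a k ^+ 2) / 2) * cos f) *
   (expR (- (b k ^+ 2 * u ^+ 2) / 2) * cos (u * c k)))%:E)%E.
  (* The product of two cosines yields the signs [e = 1] and [e = - 1]. As [a k = 0], slot [k] is
     free: filling it adds [u ^ 2 * b k ^ 2] to the sum of squares without a cross term, and [a']
     still vanishes on [s]. *)
  pose a' (e : R) j := if j == k then e * u * b k else a j.
  have sum_a' (e : R) w : \sum_j a' e j * W w j = \sum_j a j * W w j + e * u * b k * W w k.
    rewrite (bigD1 k)//= [in RHS](bigD1 k)//= a0 ?mem_head// /a' eqxx.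
    rewrite (eq_bigr (fun i => a i * W w i)); last by move=> i /negbTE ->.
    by rewrite mul0r add0r addrC.
  have sq_a' (e : R) : e ^+ 2 = 1 ->
      \sum_j a' e j ^+ 2 = \sum_j a j ^+ 2 + u ^+ 2 * b k ^+ 2.
    move=> e1; rewrite (bigD1 k)//= [in RHS](bigD1 k)//= a0 ?mem_head// /a' eqxx.
    rewrite (eq_bigr (fun i => a i ^+ 2)); last by move=> i /negbTE ->.
    by rewrite expr0n/= add0r addrC -mulrA exprMn e1 mul1r exprMn.
  have a'0 (e : R) j : j \in s -> a' e j = 0.
    move=> js; rewrite /a'; case: eqP => [jk|_]; first by rewrite -jk js in ks.
    by apply: a0; rewrite inE js orbT.
  pose g (e : R) w := \prod_(k <- s) K k w * cos (\sum_j a' e j * W w j + (f - e * u * c k)).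
  transitivity (2^-1%:E * (\int[P]_w (g 1 w)%:E + \int[P]_w (g (- 1) w)%:E))%E.
    rewrite -integralD//; [|exact: integrable_prodK|exact: integrable_prodK].
    rewrite -integralZl//; last first.
      by apply: (integrableD measurableT); exact: integrable_prodK.
    apply: eq_integral => w _; rewrite /F /g/= -EFinD -EFinM; congr EFin.
    rewrite -mulrA cos_mul -mulrDr mulrCA; congr (_ * (_ * (cos _ + cos _))).
      by rewrite sum_a'; ring.
    by rewrite sum_a'; ring.
  rewrite /g !IH//; [|exact: a'0|exact: a'0].
  rewrite !sq_a' ?expr1n ?sqrrN ?expr1n// -EFinD -EFinM; congr EFin.
  rewrite mulN1r !mulNr mul1r opprK cosB cosD.
  have -> : - ((\sum_j a j ^+ 2 + u ^+ 2 * b k ^+ 2) / 2) =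
      - ((\sum_j a j ^+ 2) / 2) + - (b k ^+ 2 * u ^+ 2 / 2) by field.
  by rewrite expRD; field.
under eq_integral do rewrite half EFinM.
rewrite integralZl//; last first.
  apply: (@bounded_integrable_probability _ _ _ _ _ 1).
  - apply: measurable_funM; last by apply: measurableT_comp => //; exact: measurable_funM.
    apply: measurableT_comp => //; apply: measurable_funM => //.
    by apply: measurableT_comp => //; apply: measurable_funM => //; exact: measurable_funX.
  - move=> u; rewrite normrM mulr_ile1//.
    rewrite ger0_norm ?expR_ge0// -expR0 ler_expR mulNr oppr_le0 divr_ge0//.
    by rewrite mulr_ge0 ?sqr_ge0.
by rewrite normal_expRsq_cos -EFinM big_cons; congr EFin; ring.
Qed.
End kernel.

(** The absorption argument of [gaussian_kernel_charfun] with exponentials for cosines: positivity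
    allows Tonelli, and [c < 1] keeps the final integral over [u] finite. *)
Lemma gaussian_square_mgf (c : R) (s : seq 'I_p) (a : 'I_p -> R) :
  0 <= c < 1 ->
  uniq s -> (forall k, k \in s -> a k = 0) ->
  (\int[P]_w (\prod_(k <- s) expR (c * W w k ^+ 2 / 2) * expR (\sum_k a k * W w k))%:E =
   ((Num.sqrt (1 - c))^-1 ^+ size s * expR ((\sum_k a k ^+ 2) / 2))%:E)%E.
Proof.
move=> /andP[c0 c1]; elim: s a => [|k s IH] a.
  move=> _ _; rewrite mul1r -gaussian_mgf.
  by apply: eq_integral => w _; rewrite big_nil mul1r.
move=> /= /andP[ks us] a0.
pose N := @normal_prob R 0 1.
pose F (z : Omega * R) : R := \prod_(j <- s) expR (c * W z.1 j ^+ 2 / 2) *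
  expR (\sum_j a j * W z.1 j) * expR (Num.sqrt c * W z.1 k * z.2).
have mF : measurable_fun setT F.
  apply: measurable_funM; first apply: measurable_funM.
  - apply: (measurableT_comp (f := fun w => \prod_(j <- s) expR (c * W w j ^+ 2 / 2))) measurable_fst.
    apply: measurable_prod => j _; apply: measurableT_comp => //.
    apply: measurable_funM => //; apply: measurable_funM => //; exact: measurable_funX.
  - apply: (measurableT_comp (f := fun w => expR (\sum_j a j * W w j))) measurable_fst.
    exact: measurableT_comp.
  - apply: measurableT_comp => //; apply: measurable_funM => //.
    apply: (measurableT_comp (f := fun w => Num.sqrt c * W w k)) measurable_fst.
    exact: measurable_funM.
have F0 z : (0 <= (F z)%:E)%E.
  rewrite lee_fin; apply: mulr_ge0; last exact: expR_ge0.
  apply: mulr_ge0; last exact: expR_ge0.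
  by apply: prodr_ge0 => i _; exact: expR_ge0.
transitivity (\int[P]_w \int[N]_u (F (w, u))%:E)%E.
  apply: eq_integral => w _; rewrite /F/=.
  under [RHS]eq_integral do rewrite EFinM.
  rewrite ge0_integralZl_EFin//.
  - by rewrite expRsq_expR_mix// -EFinM big_cons; congr EFin; ring.
  - by apply/measurable_EFinP; apply: measurableT_comp => //; exact: measurable_funM.
  - by rewrite mulr_ge0 ?expR_ge0// prodr_ge0// => i _; exact: expR_ge0.
transitivity (\int[N]_u \int[P]_w (F (w, u))%:E)%E.
  have mF' : measurable_fun setT (EFin \o F) by exact/measurable_EFinP.
  exact: (@fubini_tonelli _ _ _ _ R P (@normal_prob R 0 1) (EFin \o F) mF' F0).
have half u : (\int[P]_w (F (w, u))%:E =
    ((Num.sqrt (1 - c))^-1 ^+ size s * expR ((\sum_k a k ^+ 2) / 2))%:E *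
    (expR (- ((- c) * u ^+ 2) / 2))%:E)%E.
  pose a' j := if j == k then Num.sqrt c * u else a j.
  rewrite -EFinM -mulrA -expRD.
  have -> : (\sum_k a k ^+ 2) / 2 + - ((- c) * u ^+ 2) / 2 = (\sum_k a' k ^+ 2) / 2.
    rewrite (bigD1 k)//= [in RHS](bigD1 k)//= a0 ?mem_head// /a' eqxx exprMn sqr_sqrtr//.
    rewrite (eq_bigr (fun i => a' i ^+ 2)); last by move=> i ik; rewrite /a' (negbTE ik).
    by rewrite /a'; field.
  rewrite -IH//; last first.
    by move=> j js; rewrite /a'; case: eqP => [jk|_]; [rewrite jk (negbTE ks) in js|apply: a0; rewrite inE js orbT].
  apply: eq_integral => w _; rewrite /F/= -mulrA -expRD; congr (_ * expR _)%:E.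
  rewrite (bigD1 k)//= [in RHS](bigD1 k)//= a0 ?mem_head// /a' eqxx.
  rewrite [in RHS](eq_bigr (fun i => a i * W w i)); last by move=> i /negbTE ->.
  ring.
under eq_integral do rewrite half.
rewrite ge0_integralZl_EFin//.
- rewrite normal_integral_expRsq//; last by rewrite expr1n mulr1 subr_gt0.
  by rewrite -EFinM expr1n mulr1 exprS; congr EFin; ring.
- apply/measurable_EFinP; apply: measurableT_comp => //; apply: measurable_funM => //.
  apply: measurableT_comp => //; apply: measurable_funM => //; exact: measurable_funX.
Qed.
End gaussian.

(** * Independence and concentration *)

(** The bound [exp (- x) >= (1 - x / 4) ^ 4] reduces the claim to a polynomial inequality in
    [y = x / 4], whose critical factor [6 - 44 * y] is still positive at [y = 1 / 8]. The square of
    [1 - x / 2] would be too weak near [x = 1 / 2]. *)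
Lemma expR_le1DxDsqr (R : realType) (x : R) : `|x| <= 2^-1 -> expR x <= 1 + x + x ^+ 2.
Proof.
rewrite ler_norml => /andP[x1 x2].
pose y := x / 4; have xy : x = 4 * y by rewrite /y; field.
have y1 : - 8^-1 <= y by rewrite /y; lra.
have y2 : y <= 8^-1 by rewrite /y; lra.
have e4 : (1 - y) ^+ 4 <= expR (- x).
  rewrite xy (_ : - (4 * y) = 4%:R * (- y)); last by rewrite mulrN.
  rewrite expRM_natl lerXn2r ?nnegrE ?expR_ge0//; first by lra.
  exact: expR_ge1Dx.
have q0 : 0 <= 1 + x + x ^+ 2 by apply: addr_ge0; [lra|exact: sqr_ge0].
rewrite -[expR x]mul1r -ler_pdivlMr ?expR_gt0// -expRN.
apply: le_trans (ler_wpM2l q0 e4).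
have -> : (1 + x + x ^+ 2) * (1 - y) ^+ 4 =
  1 + y ^+ 2 * ((6 - 44 * y) + y ^+ 2 * ((81 - 60 * y) + 16 * y ^+ 2)).
  by rewrite xy; ring.
have h1 : 0 <= 6 - 44 * y by lra.
have h2 : 0 <= 81 - 60 * y by lra.
rewrite lerDl; apply: mulr_ge0; first exact: sqr_ge0.
apply: addr_ge0 => //; apply: mulr_ge0; first exact: sqr_ge0.
by apply: addr_ge0 => //; apply: mulr_ge0 => //; exact: sqr_ge0.
Qed.

Section independence.
Context d (Omega : measurableType d) (R : realType) (P : probability Omega R).
Variables (p : nat) (X : nat -> Omega -> 'rV[R]_p).
Hypothesis rX : forall i, random_vector (X i).
Hypothesis iX : mutually_independent P X.

(** The generators of [sigma_of (X i)], named so that this sigma-algebra becomes a measurable type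
    and the usual closure lemmas prove [sigma_meas]. *)
Definition coord_gen (i : nat) : set (set Omega) :=
  [set E | exists (k : 'I_p) (B : set R), measurable B /\
           E = (fun w => X i w 0 k) @^-1` B].

Definition sigma_meas (i : nat) (g : Omega -> R) : Prop :=
  measurable_fun (setT : set (g_sigma_algebraType (coord_gen i))) g.

Lemma sigma_of_measurable i E : sigma_of (X i) E -> measurable E.
Proof.
apply: smallest_sub; first exact: sigma_algebra_measurable.
move=> _ [k [B [mB ->]]]; rewrite -[X in measurable X]setTI.
exact: (rX i).
Qed.

Lemma sigma_meas_coord i k : sigma_meas i (fun w => X i w 0 k).
Proof.
move=> _ B mB; rewrite setTI; apply: sub_sigma_algebra.
by exists k, B; split.
Qed.

Lemma sigma_meas_measurable i g : sigma_meas i g -> measurable_fun setT g.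
Proof.
move=> mg _ B mB; have := mg measurableT B mB.
exact: sigma_of_measurable.
Qed.

Lemma indic_bigsetI (s : seq nat) (E : nat -> set Omega) w :
  \1_(\big[setI/setT]_(i <- s) E i) w = \prod_(i <- s) \1_(E i) w :> R.
Proof.
elim: s => [|i s IH]; first by rewrite !big_nil indicT.
by rewrite !big_cons -IH indicI.
Qed.

(** Independence is given for events, so indices pass one by one from the events [s2] to the
    functions [s1]. By induction, the weight [G] of the other indices defines the measure [c * P A]
    on events [A] of index [i], and [g i] is integrated against that measure. *)
Lemma indep_integral_prod_indic (g : nat -> Omega -> R) (e : nat -> R)
  (s1 s2 : seq nat) (E : nat -> set Omega) :
  (forall i, sigma_meas i (g i)) -> (forall i w, 0 <= g i w) ->
  (forall i, \int[P]_w (g i w)%:E = (e i)%:E)%E ->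
  uniq (s1 ++ s2) -> (forall i, i \in s2 -> sigma_of (X i) (E i)) ->
  (\int[P]_w (\prod_(i <- s1) g i w * \prod_(i <- s2) \1_(E i) w)%:E =
  (\prod_(i <- s1) e i * \prod_(i <- s2) fine (P (E i)))%:E)%E.
Proof.
move=> mg g0 ge; elim: s1 s2 E => [|i s1 IH] s2 E.
  move=> us2 mE; rewrite big_nil mul1r.
  under eq_integral do rewrite big_nil mul1r -indic_bigsetI.
  have mbig : measurable (\big[setI/setT]_(i <- s2) E i).
    rewrite big_seq; apply: big_ind => //; first by move=> A B; exact: measurableI.
    by move=> i /mE; exact: sigma_of_measurable.
  rewrite integral_indic// setIT; apply: etrans (iX us2 mE) _.
  elim: s2 {us2 mbig} mE => [|j s2 IHs] mE; first by rewrite !big_nil.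
  rewrite !big_cons EFinM IHs; last by move=> k ks; apply: mE; rewrite inE ks orbT.
  have mEj : measurable (E j) by apply: (@sigma_of_measurable j); apply: mE; exact: mem_head.
  by rewrite fineK// fin_num_measure.
rewrite cat_cons cons_uniq => /andP[]; rewrite mem_cat negb_or => /andP[is1 is2] us mE.
pose G w : R := \prod_(j <- s1) g j w * \prod_(j <- s2) \1_(E j) w.
have mG : measurable_fun setT G.
  apply: measurable_funM.
    by apply: measurable_prod => j _; exact: sigma_meas_measurable.
  rewrite (_ : (fun w => _) = \1_(\big[setI/setT]_(i <- s2) E i)); last first.
    by apply/funext => w; rewrite indic_bigsetI.
  apply: measurable_indic.
  rewrite big_seq; apply: big_ind => //; first by move=> A B; exact: measurableI.
  by move=> j /mE; exact: sigma_of_measurable.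
have G0 w : 0 <= G w.
  by apply: mulr_ge0; apply: prodr_ge0 => j _.
have e0 j : 0 <= e j.
  by rewrite -lee_fin -ge; apply: integral_ge0 => w _; rewrite lee_fin.
pose c := \prod_(j <- s1) e j * \prod_(j <- s2) fine (P (E j)).
have c0 : 0 <= c.
  by apply: mulr_ge0; apply: prodr_ge0 => j _ //; rewrite fine_ge0.
pose T := g_sigma_algebraType (coord_gen i).
have mid : measurable_fun setT (idfun : Omega -> T).
  by move=> _ B mB; rewrite setTI; exact: (@sigma_of_measurable i).
pose m0 : {measure set T -> \bar R} := mscale (NngNum c0) (pushforward P (idfun : Omega -> T)).
pose m := m0 mid.
have mE' A : measurable (A : set T) ->
    m A = (\int[P]_w ((\1_A (idfun w))%:E * (G w)%:E))%E.
  move=> mA; pose E' j := if j == i then A else E j.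
  have us' : uniq (s1 ++ i :: s2).
      by rewrite -cat1s uniq_catCA /= mem_cat negb_or is1 is2 us.
  have hE' j : j \in i :: s2 -> sigma_of (X j) (E' j).
    by rewrite inE /E'; case: eqP => [->//|_ /= js]; exact: mE.
  have E's j : j \in s2 -> E' j = E j.
    by move=> js; rewrite /E'; case: eqP => // ji; rewrite -ji js in is2.
  have E'i : E' i = A by rewrite /E' eqxx.
  have := IH (i :: s2) E' us' hE'.
  rewrite big_cons E'i.
  have -> : \prod_(j <- s2) fine (P (E' j)) = \prod_(j <- s2) fine (P (E j)).
    by apply: eq_big_seq => j js; rewrite E's.
  rewrite mulrCA EFinM fineK ?fin_num_measure//; last exact: (@sigma_of_measurable i).
  move=> IHE; have -> : m A = (c%:E * P A)%E by [].
  rewrite muleC /c -IHE.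
  apply: eq_integral => w _; rewrite -EFinM; congr EFin.
  rewrite big_cons E'i.
  have -> : \prod_(j <- s2) \1_(E' j) w = \prod_(j <- s2) \1_(E j) w :> R.
    by apply: eq_big_seq => j js; rewrite E's.
  by rewrite /G; ring.
have mgi : measurable_fun (setT : set T) (EFin \o g i).
  by apply/measurable_EFinP; exact: mg.
have := @ge0_integral_comp_density _ _ Omega T R P m idfun G mid G0 mG mE' (EFin \o g i).
rewrite /m /m0 ge0_integral_mscale//=; last by move=> w _; rewrite lee_fin.
rewrite ge0_integral_pushforward//; last by move=> w _; rewrite lee_fin.
rewrite preimage_setT /= ge -EFinM => h.
rewrite big_cons -mulrA mulrC -/c h//; last by move=> w; rewrite lee_fin.
by apply: eq_integral => w _; rewrite -EFinM big_cons /G mulrA.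
Qed.

Lemma indep_integral_prod (g : nat -> Omega -> R) (e : nat -> R) (s : seq nat) :
  (forall i, sigma_meas i (g i)) -> (forall i w, 0 <= g i w) ->
  (forall i, \int[P]_w (g i w)%:E = (e i)%:E)%E -> uniq s ->
  (\int[P]_w (\prod_(i <- s) g i w)%:E = (\prod_(i <- s) e i)%:E)%E.
Proof.
move=> mg g0 ge us.
have := @indep_integral_prod_indic g e s [::] (fun=> setT) mg g0 ge.
rewrite cats0 big_nil mulr1 => <-//.
by apply: eq_integral => w _; rewrite big_nil mulr1.
Qed.

(** * Relative Chernoff bound for independent variables in [0, 1] *)

Section chernoff.
Variables (z : nat -> Omega -> R) (c : R).
Hypothesis mz : forall i, sigma_meas i (z i).
Hypothesis z01 : forall i w, 0 <= z i w <= 1.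
Hypothesis zc : forall i, (\int[P]_w (z i w)%:E = c%:E)%E.

Let c0 : 0 <= c.
Proof.
rewrite -lee_fin -(zc 0); apply: integral_ge0 => w _; rewrite lee_fin.
by case/andP: (z01 0 w).
Qed.

Let mzT i : measurable_fun setT (z i).
Proof. exact: sigma_meas_measurable. Qed.

Let msumz n : measurable_fun setT (fun w => \sum_(i < n) z i w).
Proof. by apply: measurable_sum. Qed.

(** Since [0 <= z <= 1], [z ^ 2 <= z], so the quadratic bound on the exponential is linear in [z]
    and only the mean [c] enters. Deviations then scale with [n * c], which matters when [c] is a
    negative power of [n]. *)
Let exp_mgf (s : R) i : `|s| <= 2^-1 ->
  (\int[P]_w (expR (s * z i w))%:E <= (expR (c * (s + s ^+ 2)))%:E)%E.
Proof.
move=> s1.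
have mlin : measurable_fun setT (fun w => (1 + (s + s ^+ 2)%:E * (z i w)%:E)%E).
  apply: (@eq_measurable_fun _ _ _ _ _ (EFin \o (fun w => 1 + (s + s ^+ 2) * z i w))) => //.
  by apply/measurable_EFinP; apply: measurable_funD => //; exact: measurable_funM.
have pt w : expR (s * z i w) <= 1 + (s + s ^+ 2) * z i w.
  have /andP[h0 h1] := z01 i w.
  have : `|s * z i w| <= 2^-1.
    by rewrite normrM (ger0_norm h0); apply: le_trans s1; rewrite ler_piMr.
  move=> /expR_le1DxDsqr; move=> /le_trans; apply.
  rewrite mulrDl addrA lerD2l exprMn ler_wpM2l ?sqr_ge0//.
  by rewrite expr2 ler_piMr.
apply: (@le_trans _ _ (\int[P]_w (1 + (s + s ^+ 2)%:E * (z i w)%:E))%E).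
  apply: ge0_le_integral => //.
  - by apply/measurable_EFinP; apply: measurableT_comp => //; exact: measurable_funM.
  - by move=> w _; rewrite -EFinM -EFinD lee_fin.
have iz : P.-integrable setT (EFin \o z i).
  apply: measurable_bounded_integrable => //.
    by rewrite (le_lt_trans (probability_le1 _ _))// ltry.
  exists 1; split=> // M M1 w _; apply: le_trans (ltW M1).
  by have /andP[h0 h1] := z01 i w; rewrite ger0_norm.
rewrite integralD//; last 2 first.
- exact: finite_measure_integrable_cst.
- exact: integrableZl.
rewrite integralZl// zc integral_cst// [X in (1 * X)%E](_ : _ = 1%E); last exact: probability_setT.
rewrite mul1e -EFinM -EFinD lee_fin mulrC; exact: expR_ge1Dx.
Qed.

Let markov_exp n (s a : R) : `|s| <= 2^-1 ->
  (P [set w | (0 <= s * (\sum_(i < n) z i w - a))%R] <=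
   (expR (n%:R * c * (s + s ^+ 2) - s * a))%:E)%E.
Proof.
move=> s1; set A := [set w | _].
have mlin : measurable_fun setT (fun w => s * (\sum_(i < n) z i w - a)).
  by apply: measurable_funM => //; apply: measurable_funB.
have mA : measurable A.
  rewrite /A (_ : [set w | _] = (fun w => s * (\sum_(i < n) z i w - a)) @^-1` `[0, +oo[%classic).
    by rewrite -[X in measurable X]setTI; exact: mlin.
  by apply/seteqP; split => w /=; rewrite in_itv/= andbT.
pose e i := fine (\int[P]_w (expR (s * z i w))%:E)%E.
have eE i : (\int[P]_w (expR (s * z i w))%:E = (e i)%:E)%E.
  rewrite fineK// ge0_fin_numE; first exact: le_lt_trans (exp_mgf i s1) (ltry _).
  by apply: integral_ge0 => w _; rewrite lee_fin expR_ge0.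
have e0 i : 0 <= e i.
  by rewrite fine_ge0//; apply: integral_ge0 => w _; rewrite lee_fin expR_ge0.
have ele i : e i <= expR (c * (s + s ^+ 2)) by rewrite -lee_fin -eE exp_mgf.
apply: (@le_trans _ _ (\int[P]_w (expR (s * (\sum_(i < n) z i w - a)))%:E)%E).
  rewrite -[X in P X]setIT -integral_indic//.
  apply: ge0_le_integral => //.
  - by apply/measurable_EFinP.
  - by apply/measurable_EFinP; exact: measurableT_comp.
  - move=> w _; rewrite lee_fin indicE; case: (boolP (w \in A)) => [/set_mem Aw|_]; last exact: expR_ge0.
    by rewrite -[leLHS]expR0 ler_expR.
have -> : (\int[P]_w (expR (s * (\sum_(i < n) z i w - a)))%:E =
    (expR (- (s * a)))%:E * \int[P]_w (\prod_(0 <= i < n) expR (s * z i w))%:E)%E.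
  rewrite -ge0_integralZl_EFin ?expR_ge0//; last 2 first.
  - by move=> w _; rewrite lee_fin; apply: prodr_ge0 => i _; exact: expR_ge0.
  - apply/measurable_EFinP; apply: measurable_prod => i _.
    by apply: measurableT_comp => //; exact: measurable_funM.
  apply: eq_integral => w _; rewrite -EFinM; congr EFin.
  by rewrite big_mkord -expR_sum -expRD -mulr_sumr mulrBr addrC.
have mexp i : sigma_meas i (fun w => expR (s * z i w)).
  by apply: measurableT_comp => //; apply: measurable_funM => //; exact: mz.
rewrite (@indep_integral_prod (fun i w => expR (s * z i w)) e)//; last exact: iota_uniq.
rewrite -EFinM lee_fin addrC expRD ler_wpM2l ?expR_ge0//.
rewrite -mulrA expRM_natl big_mkord.
apply: (@le_trans _ _ (\prod_(i < n) expR (c * (s + s ^+ 2)))).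
  by apply: ler_prod => i _; rewrite e0 ele.
by rewrite prodr_const card_ord.
Qed.

Lemma chernoff01 n (del : R) : 0 < del <= 1 ->
  (P [set w | ~~ (`|\sum_(i < n) z i w - n%:R * c| <= del * (n%:R * c))%R] <=
   (2 * expR (- (n%:R * c * del ^+ 2 / 4)))%:E)%E.
Proof.
move=> /andP[d0 d1].
pose A s a := [set w | (0 <= s * (\sum_(i < n) z i w - a))%R].
have mA s a : measurable (A s a).
  rewrite /A (_ : [set w | _] = (fun w => s * (\sum_(i < n) z i w - a)) @^-1` `[0, +oo[%classic).
    rewrite -[X in measurable X]setTI.
    have ml : measurable_fun setT (fun w => s * (\sum_(i < n) z i w - a)).
      by apply: measurable_funM => //; apply: measurable_funB.
    exact: ml.
  by apply/seteqP; split => w /=; rewrite in_itv/= andbT.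
(* [s = del / 2] minimises [s ^ 2 - s * del], the exponent of the upper tail in units of [n * c];
   the lower tail is its mirror image. *)
have d2 : `|del / 2| <= 2^-1 by rewrite ger0_norm; lra.
have nd2 : `|- (del / 2)| <= 2^-1 by rewrite normrN.
apply: (@le_trans _ _ (P (A (del / 2) ((1 + del) * (n%:R * c)) `|`
                          A (- (del / 2)) ((1 - del) * (n%:R * c))))).
  apply: le_measure; rewrite ?inE.
  - rewrite (_ : [set w | _] = (fun w => `|\sum_(i < n) z i w - n%:R * c|) @^-1` `]del * (n%:R * c), +oo[%classic).
      rewrite -[X in measurable X]setTI.
      have ml : measurable_fun setT (fun w => `|\sum_(i < n) z i w - n%:R * c|).
        by apply: measurableT_comp => //; apply: measurable_funB.
      exact: ml.
    by apply/seteqP; split => w /=; rewrite in_itv/= andbT ltNge.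
  - exact: measurableU.
  - move=> w /=; rewrite -ltNge ltr_normr => /orP[h|h].
      by left; rewrite /A /=; apply: mulr_ge0; lra.
    by right; rewrite /A /= mulNr oppr_ge0; apply: mulr_ge0_le0; lra.
apply: (le_trans (measureU2 _ (mA _ _) (mA _ _))).
set F := expR _; rewrite (_ : 2 * F = F + F); last by ring.
rewrite EFinD /F; apply: leeD.
- apply: (le_trans (markov_exp n _ d2)); rewrite lee_fin ler_expR.
  by rewrite le_eqVlt; apply/orP; left; apply/eqP; field.
- apply: (le_trans (markov_exp n _ nd2)); rewrite lee_fin ler_expR.
  by rewrite le_eqVlt; apply/orP; left; apply/eqP; field.
Qed.
End chernoff.
End independence.

Lemma borel_cantelli_ae d (Omega : measurableType d) (R : realType)
  (P : probability Omega R) (B : nat -> set Omega) (u : nat -> R) :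
  (forall n, measurable (B n)) -> (forall n, (P (B n) <= (u n)%:E)%E) ->
  cvgn (series u) ->
  {ae P, forall w, \forall n \near \oo, ~ B n w}.
Proof.
move=> mB Bu cu.
have u0 n : 0 <= u n by rewrite -lee_fin; apply: le_trans (Bu n).
exists (lim_sup_set B); split.
- by apply: bigcap_measurable => // n _; exact: bigcup_measurable.
- apply: lim_sup_set_cvg0 => //.
  apply: (@le_lt_trans _ _ (\sum_(n <oo) (u n)%:E)%E).
    by apply: lee_nneseries => n *; [exact: measure_ge0|exact: Bu].
  rewrite (_ : (\sum_(n <oo) (u n)%:E)%E = (limn (series u))%:E) ?ltry//.
  rewrite -EFin_lim//; congr (limn _); apply/funext => n /=.
  by rewrite /series/= sumEFin.
- move=> w /= nw n _; apply: contrapT => h; apply: nw; exists n => // m /= nm.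
  by move=> Bm; apply: h; exists m.
Qed.

(** * The real spectral theorem *)

Section spectral.
Context {R : realType}.

Lemma dotmx_eq0 n (v : 'rV[R]_n) : ((v *m v^T) 0 0 == 0) = (v == 0).
Proof.
rewrite mxE; under eq_bigr do rewrite mxE -expr2.
rewrite psumr_eq0; last by move=> i _; exact: sqr_ge0.
apply/idP/eqP => [/allP h|->]; last by apply/allP => i _; rewrite mxE expr0n eqxx.
apply/rowP => i; rewrite mxE; apply/eqP.
by have := h i; rewrite mem_index_enum sqrf_eq0; exact.
Qed.

Lemma dotmx_ge0 n (v : 'rV[R]_n) : 0 <= (v *m v^T) 0 0.
Proof. by rewrite mxE sumr_ge0// => i _; rewrite mxE -expr2 sqr_ge0. Qed.

(** With [w] the conjugate transpose of a complex eigenvector [v], symmetry makes both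
    [v A w = a * (v w)] and [v w] self-conjugate, and [v w] is nonzero; hence [a] is real, and a
    root of the characteristic polynomial over [R]. *)
Lemma symmetric_eigenvalue n (A : 'M[R]_n.+1) : A^T = A -> exists r, eigenvalue A r.
Proof.
move=> As; pose f := real_complex R.
have [a /eigenvalueP[v va v0]] := eigenvalue_closed (map_mx f A) isT.
pose w := (map_mx (@Num.conj _) v)^T.
have fA : map_mx Num.conj (map_mx f A)^T = map_mx f A.
  by apply/matrixP => i j; rewrite -[in RHS]As !mxE; exact: conjc_real.
have wt : map_mx Num.conj w^T = v.
  by rewrite /w trmxK; apply/matrixP => i j; rewrite !mxE conjCK.
have vt : map_mx Num.conj v^T = w by rewrite /w map_trmx.
have N0 : (v *m w) 0 0 != 0.
  rewrite mxE; apply: contra v0 => h; apply/eqP/rowP => k.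
  move: h; under eq_bigr do rewrite !mxE -normCK.
  rewrite psumr_eq0; last by move=> i _; rewrite exprn_ge0.
  move=> /allP/(_ k); rewrite mem_index_enum => /(_ isT)/=.
  by rewrite sqrf_eq0 normr_eq0 mxE => /eqP.
have Q : v *m map_mx f A *m w = a *: (v *m w) by rewrite va -scalemxAl.
have cN : map_mx Num.conj (v *m w)^T = v *m w.
  by rewrite trmx_mul map_mxM wt vt.
have cQ : map_mx Num.conj (v *m map_mx f A *m w)^T = v *m map_mx f A *m w.
  by rewrite !trmx_mul !map_mxM wt vt fA mulmxA.
have : Num.conj a = a.
  move: cQ; rewrite Q linearZ/= map_mxZ cN => /matrixP/(_ 0 0).
  by rewrite [LHS]mxE [RHS]mxE => /(mulIf N0).
move=> /CrealP ar; exists (complex.Re a).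
have aE : a = f (complex.Re a) by rewrite /f RRe_real.
have : root (char_poly (map_mx f A)) a.
  by rewrite -eigenvalue_root_char; apply/eigenvalueP; exists v.
by rewrite {1}aE -map_char_poly fmorph_root -eigenvalue_root_char.
Qed.

Lemma reflection_orthogonal n (u : 'rV[R]_n) (q : R) : q != 0 -> u *m u^T = q%:M ->
  let H := 1%:M - (2 / q) *: (u^T *m u) in H *m H^T = 1%:M.
Proof.
move=> q0 uu /=.
have -> : (1%:M - (2 / q) *: (u^T *m u))^T = 1%:M - (2 / q) *: (u^T *m u).
  by rewrite linearB linearZ/= trmx1 trmx_mul trmxK.
rewrite mulmxBl mul1mx mulmxBr mulmx1 -scalemxAl -scalemxAr.
rewrite mulmxA -(mulmxA _ u) uu mul_mx_scalar -scalemxAl !scalerA.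
rewrite (_ : 2 / q * (2 / q * q) = 2 / q + 2 / q); last by field.
rewrite scalerDl; set X := _ *: _.
have -> : X - (X + X) = - X by rewrite opprD addrA subrr sub0r.
by rewrite opprK subrK.
Qed.

(** The reflection in the hyperplane orthogonal to [v - e] exchanges the unit vectors [e] and [v];
    when they coincide the identity serves. *)
Lemma householder n (v : 'rV[R]_n.+1) : (v *m v^T) 0 0 = 1 ->
  exists H : 'M[R]_n.+1, H *m H^T = 1%:M /\ delta_mx 0 0 *m H = v.
Proof.
move=> v1; pose e : 'rV[R]_n.+1 := delta_mx 0 0.
have ee : e *m e^T = 1%:M.
  by rewrite trmx_delta mul_delta_mx; apply/matrixP => i j; rewrite !mxE !ord1.
have vv : v *m v^T = 1%:M.
  by apply/matrixP => i j; rewrite !ord1 v1 mxE.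
have [->|ve] := eqVneq v e.
  by exists 1%:M; rewrite trmx1 mulmx1 mulmx1.
pose u := v - e; pose q := (u *m u^T) 0 0.
have q0 : q != 0 by rewrite dotmx_eq0 subr_eq0.
have uu : u *m u^T = q%:M by apply/matrixP => i j; rewrite !ord1 !mxE mulr1n /q mxE.
exists (1%:M - (2 / q) *: (u^T *m u)).
split; first exact: reflection_orthogonal.
have uE : e *m u^T = (- (q / 2))%:M.
  have : u *m u^T = v *m v^T - v *m e^T - (e *m v^T - e *m e^T).
    by rewrite /u linearB/= mulmxBl !mulmxBr.
  have vee : v *m e^T = e *m v^T.
    by apply/matrixP => i j; rewrite !ord1 !mxE; apply: eq_bigr => l _; rewrite !mxE mulrC.
  rewrite uu vv ee vee => h.
  rewrite /u linearB/= mulmxBr ee.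
  move: h => /matrixP/(_ 0 0); rewrite !mxE !eqxx !mulr1n => h.
  apply/matrixP => i j; rewrite !ord1 !mxE !eqxx !mulr1n.
  by move: h; set s := \sum_(_ < _) _; lra.
rewrite -/e mulmxBr mulmx1 -scalemxAr mulmxA uE mul_scalar_mx scalerA.
have -> : 2 / q * - (q / 2) = -1 by field.
by rewrite scaleN1r opprK /u addrC subrK.
Qed.

(** Deflation: [H] carries the first basis vector to a unit eigenvector, so the conjugated matrix
    has first row [r, 0, ..., 0]; symmetry clears the first column, and induction diagonalises the
    remaining block. *)
Theorem spectral_symmetric n (A : 'M[R]_n) : A^T = A ->
  exists U : 'M[R]_n, U *m U^T = 1%:M /\ is_diag_mx (U *m A *m U^T).
Proof.
elim: n A => [|n IH] A As.
  by exists 1%:M; rewrite trmx1 mulmx1; split=> //; apply/is_diag_mxP => -[].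
have [r /eigenvalueP[v0 v0A v00]] := symmetric_eigenvalue As.
pose c := (Num.sqrt ((v0 *m v0^T) 0 0))^-1.
pose v := c *: v0.
have vA : v *m A = r *: v by rewrite /v -scalemxAl v0A !scalerA mulrC.
have v1 : (v *m v^T) 0 0 = 1.
  rewrite /v linearZ/= -scalemxAl -scalemxAr scalerA mxE /c -invfM -expr2.
  by rewrite sqr_sqrtr ?dotmx_ge0// mulVf// dotmx_eq0.
have [H [HH eH]] := householder v1.
pose B : 'M[R]_(1 + n) := H *m A *m H^T.
have Bs : B^T = B by rewrite /B !trmx_mul trmxK As mulmxA.
have B0 : delta_mx 0 0 *m B = r *: (delta_mx 0 0 : 'rV[R]_(1 + n)).
  rewrite /B !mulmxA eH vA -scalemxAl -{1}eH -mulmxA HH mulmx1//.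
have ur : ursubmx B = 0.
  apply/matrixP => i j; rewrite !mxE.
  have /matrixP/(_ 0 (rshift 1 j)) := B0; rewrite -rowE !mxE => h.
  have -> : lshift n i = 0 by apply/val_inj; rewrite /= ord1.
  by rewrite h andbF mulr0.
have dl : dlsubmx B = 0.
  by rewrite -[dlsubmx B]trmxK trmx_dlsub Bs ur trmx0.
have drs : (drsubmx B)^T = drsubmx B by rewrite trmx_drsub Bs.
have [U' [UU' dU']] := IH _ drs.
pose Q : 'M[R]_(1 + n) := block_mx 1%:M 0 0 U'.
have QQ : Q *m Q^T = 1%:M.
  rewrite /Q tr_block_mx trmx1 !trmx0.
  rewrite mulmx_block !mulmx0 !mul0mx mulmx1 !addr0 add0r UU'.
  by rewrite -scalar_mx_block.
exists ((Q : 'M[R]_n.+1) *m H); split.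
  by rewrite trmx_mul mulmxA -(mulmxA (Q : 'M[R]_n.+1)) HH mulmx1.
have -> : (Q : 'M[R]_n.+1) *m H *m A *m ((Q : 'M[R]_n.+1) *m H)^T = Q *m B *m Q^T.
  by rewrite trmx_mul /B !mulmxA.
rewrite /Q -[B]submxK ur dl tr_block_mx trmx1 !trmx0 !mulmx_block.
rewrite !mulmx0 !mul0mx !mulmx1 !mul1mx !addr0 !add0r.
apply/is_diag_mxP => i j.
rewrite -(@splitK 1 n i) -(@splitK 1 n j).
case: (@fintype.split 1 n i) => i'; case: (@fintype.split 1 n j) => j' /=.
- by rewrite !ord1 eqxx.
- by rewrite [LHS](@block_mxEur _ 1 n 1 n) mul0mx mxE.
- by rewrite [LHS](@block_mxEdl _ 1 n 1 n) mxE.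
- move=> ij; rewrite [LHS](@block_mxEdr _ 1 n 1 n); move/is_diag_mxP : dU'; apply.
  by apply: contra ij => /eqP ->.
Qed.
End spectral.

(** * The mean-shift iteration *)

Section mean_shift.
Context {R : realType} {p : nat}.
Implicit Types (u v : 'I_p -> R) (z y : nat -> 'I_p -> R) (n : nat).

Definition gk u : R := expR (- (\sum_k u k ^+ 2) / 2).

(** The argument [v] is arbitrary rather than a sample, because the comparison evaluates mean shift
    at grid points. *)
Definition msmean n z v (k : 'I_p) : R :=
  (\sum_(j < n) gk (fun k => v k - z j k))^-1 *
  \sum_(j < n) gk (fun k => v k - z j k) * z j k.

Definition msstep n z : nat -> 'I_p -> R := fun i => msmean n z (z i).

Definition msiter n y t := iter t (msstep n) y.

Lemma gk_gt0 u : 0 < gk u. Proof. exact: expR_gt0. Qed.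

Lemma gk_le1 u : gk u <= 1.
Proof.
rewrite /gk -expR0 ler_expR mulNr oppr_le0 divr_ge0// sumr_ge0// => k _.
exact: sqr_ge0.
Qed.

Lemma sum_gk_gt0 n z v : (0 < n)%N -> 0 < \sum_(j < n) gk (fun k => v k - z j k).
Proof.
case: n => // n _; rewrite big_ord_recl ltr_pwDl ?gk_gt0// sumr_ge0// => j _.
exact/ltW/gk_gt0.
Qed.

Lemma sum_gk_le n z v : \sum_(j < n) gk (fun k => v k - z j k) <= n%:R.
Proof.
apply: (@le_trans _ _ (\sum_(j < n) 1)); first by apply: ler_sum => j _; exact: gk_le1.
by rewrite sumr_const card_ord.
Qed.

Lemma msmeanE n z v k : (0 < n)%N ->
  (\sum_(j < n) gk (fun k => v k - z j k)) * msmean n z v k =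
  \sum_(j < n) gk (fun k => v k - z j k) * z j k.
Proof. by move=> n0; rewrite /msmean mulVKf// gt_eqF// sum_gk_gt0. Qed.

(* Doeblin-type contraction: every averaging weight is at least [e / n]. *)
Lemma msmean_contract n z v k (a b e m : R) : (0 < n)%N ->
  (forall j, (j < n)%N -> a <= z j k <= b) ->
  (forall j, (j < n)%N -> e <= gk (fun k => v k - z j k)) -> 0 <= e ->
  m = (\sum_(j < n) z j k) / n%:R ->
  e * m + (1 - e) * a <= msmean n z v k <= e * m + (1 - e) * b.
Proof.
move=> n0 zab ge e0 mE.
set S := \sum_(j < n) gk (fun k => v k - z j k).
have S0 : 0 < S by exact: sum_gk_gt0.
have Sn : S <= n%:R by exact: sum_gk_le.
have nR0 : 0 < n%:R :> R by rewrite ltr0n.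
have nm : n%:R * m = \sum_(j < n) z j k by rewrite mE mulrC divfK ?gt_eqF.
have h c (s : R) : (forall j, (j < n)%N -> 0 <= s * (c - z j k)) ->
    e * (s * (c - m)) <= s * (c - msmean n z v k).
  move=> hs.
  have nsum : n%:R * (s * (c - m)) = \sum_(j < n) s * (c - z j k).
    by rewrite mulrCA mulrBr nm -mulr_sumr sumrB sumr_const card_ord mulr_natl.
  have hm : 0 <= s * (c - m).
    by rewrite -(pmulr_rge0 _ nR0) nsum; apply: sumr_ge0 => j _; exact: hs.
  rewrite -(ler_pM2l S0).
  have -> : S * (s * (c - msmean n z v k)) =
      \sum_(j < n) gk (fun k => v k - z j k) * (s * (c - z j k)).
    rewrite mulrCA mulrBr msmeanE// /S mulr_suml -sumrB mulr_sumr.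
    by apply: eq_bigr => j _; ring.
  apply: (@le_trans _ _ (n%:R * (e * (s * (c - m))))).
    by rewrite ler_wpM2r// mulr_ge0.
  rewrite mulrCA nsum mulr_sumr.
  by apply: ler_sum => j _; rewrite ler_wpM2r ?hs ?ge.
apply/andP; split.
  have : e * (-1 * (a - m)) <= -1 * (a - msmean n z v k).
    by apply: h => j /zab/andP[]; lra.
  lra.
have : e * (1 * (b - m)) <= 1 * (b - msmean n z v k).
  by apply: h => j /zab/andP[]; lra.
lra.
Qed.

Lemma msmean_between n z v k (a b : R) : (0 < n)%N ->
  (forall j, (j < n)%N -> a <= z j k <= b) -> a <= msmean n z v k <= b.
Proof.
move=> n0 zab.
have := @msmean_contract n z v k a b 0 _ n0 zab (fun j _ => ltW (gk_gt0 _)) (lexx 0) erefl.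
by rewrite !mul0r !add0r subr0 !mul1r.
Qed.

Lemma msmean_norm_le n z v k (B : R) : (0 < n)%N ->
  (forall j, (j < n)%N -> `|z j k| <= B) -> `|msmean n z v k| <= B.
Proof.
by move=> n0 zB; rewrite ler_norml; apply: msmean_between => // j /zB; rewrite ler_norml.
Qed.

Lemma msiter_norm_le n y t s k (B : R) :
  (forall j, (j < n)%N -> `|msiter n y t j k| <= B) ->
  forall j, (j < n)%N -> `|msiter n y (s + t) j k| <= B.
Proof.
move=> h; elim: s => [//|s IH] j jn; rewrite addSn /msiter iterS.
by apply: msmean_norm_le => //; exact: leq_ltn_trans jn.
Qed.

(** All points stay in the initial box, so every kernel value is at least [e]. By [msmean_contract]
    both ends of the enclosing interval receive the same term [e * m], [m] the current mean, and the
    width shrinks by the factor [1 - e]. *)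
Lemma msiter_bounds n y (B : R) : (0 < n)%N ->
  (forall j k, (j < n)%N -> `|y j k| <= B) ->
  forall t k, exists2 a, forall j, (j < n)%N -> a <= msiter n y t j k <= a +
    (1 - expR (- (p%:R * (2 * B) ^+ 2) / 2)) ^+ t * (2 * B) & True.
Proof.
move=> n0 yB; set e := expR _.
have e1 : e <= 1.
  by rewrite /e -expR0 ler_expR mulNr oppr_le0 divr_ge0// mulr_ge0// sqr_ge0.
have zB t j k : (j < n)%N -> `|msiter n y t j k| <= B.
  by move=> jn; rewrite -[t]addn0; apply: msiter_norm_le => // i; exact: yB.
elim=> [|t IH] k.
  exists (- B) => // j jn; rewrite expr0 mul1r.
  by have := yB j k jn; rewrite /msiter/= ler_norml; lra.
have [a h _] := IH k.
set w := _ ^+ t * _ in h.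
have ge j v : (j < n)%N -> (forall k, `|v k| <= B) -> e <= gk (fun k => v k - msiter n y t j k).
  move=> jn vB; rewrite /e /gk ler_expR !mulNr lerN2 ler_pM2r//.
  apply: (@le_trans _ _ (\sum_(k < p) (2 * B) ^+ 2)); last first.
    by rewrite sumr_const card_ord [leRHS]mulr_natl.
  apply: ler_sum => l _; rewrite -[leLHS]real_normK ?num_real// lerXn2r ?nnegrE//.
    by rewrite mulr_ge0//; exact: le_trans (vB l).
  by rewrite mulrDl !mul1r (le_trans (ler_normB _ _))// lerD// zB.
exists (e * ((\sum_(j < n) msiter n y t j k) / n%:R) + (1 - e) * a) => // j jn.
have := @msmean_contract n (msiter n y t) (msiter n y t j) k a (a + w) e _ n0 h
  (fun i iN => ge i _ iN (fun l => zB t j l jn)) (expR_ge0 _) erefl.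
rewrite /msiter iterS /msstep -/(msiter n y t) exprS -mulrA -/w.
by rewrite mulrDr addrA.
Qed.

(** The widths decay geometrically and each move of point [0] stays inside the current interval, so
    its increments are summable. The second clause reduces the size of the limit to the size of all
    points at one finite time. *)
Lemma msiter_cvg n y : (0 < n)%N -> exists c : 'I_p -> R,
  (forall i k, (i < n)%N -> msiter n y t i k @[t --> \oo] --> c k) /\
  (forall t (B : R), (forall j k, (j < n)%N -> `|msiter n y t j k| <= B) ->
     forall k, `|c k| <= B).
Proof.
move=> n0.
pose B := \sum_(j < n) \sum_k `|y j k|.
have yB j k : (j < n)%N -> `|y j k| <= B.
  move=> jn; rewrite /B (bigD1 (Ordinal jn))//= (bigD1 k)//= -addrA lerDl addr_ge0//.
    by rewrite sumr_ge0.
  by rewrite sumr_ge0// => i _; rewrite sumr_ge0.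
have bd := msiter_bounds n0 yB.
set e := expR _ in bd.
have e1 : e <= 1.
  rewrite /e -expR0 ler_expR mulNr oppr_le0 divr_ge0// mulr_ge0// sqr_ge0//.
have e0 : 0 < e by exact: expR_gt0.
have q1 : `|1 - e| < 1 by rewrite ger0_norm; lra.
have q0 : 0 <= 1 - e by lra.
have diam t i j k : (i < n)%N -> (j < n)%N ->
    `|msiter n y t i k - msiter n y t j k| <= (2 * B) * (1 - e) ^+ t.
  move=> iN jn; have [a h _] := bd t k.
  have := h i iN; have := h j jn; rewrite mulrC.
  by rewrite ler_norml; lra.
have step t k : `|msiter n y t.+1 0 k - msiter n y t 0 k| <= (2 * B) * (1 - e) ^+ t.
  have [a h _] := bd t k.
  have h0 := h 0 n0.
  have h1 : a <= msiter n y t.+1 0 k <= a + (1 - e) ^+ t * (2 * B).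
    by rewrite /msiter iterS; apply: msmean_between.
  by move: h0 h1; rewrite mulrC ler_norml; lra.
have cv0 k : cvgn (fun t => msiter n y t 0 k).
  have : cvgn (series (telescope (fun t => msiter n y t 0 k))).
    apply: normed_cvg; apply: (series_le_cvg _ _ _ (@is_cvg_geometric_series _ (2 * B) (1 - e) q1)).
    - by move=> t /=.
    - move=> t; apply: le_trans (step t k) => //.
    - by move=> t; exact: step.
  move=> /cvg_ex[l hl]; apply/cvg_ex; exists (l + msiter n y 0 0 k).
  have -> : (fun t => msiter n y t 0 k) =
     (fun t => series (telescope (fun t => msiter n y t 0 k)) t + msiter n y 0 0 k).
    by apply/funext => t; rewrite telescopeK subrK.
  by apply: cvgD => //; exact: cvg_cst.
exists (fun k => limn (fun t => msiter n y t 0 k)).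
have cvi i k : (i < n)%N -> msiter n y t i k @[t --> \oo] --> limn (fun t => msiter n y t 0 k).
  move=> iN.
  have d0 : msiter n y t i k - msiter n y t 0 k @[t --> \oo] --> (0 : R).
    apply/norm_cvg0P; apply: (@squeeze_cvgr _ _ _ _ (cst 0) (fun t => (2 * B) * (1 - e) ^+ t)).
    - by apply: nearW => t /=; rewrite normr_ge0 diam.
    - exact: cvg_cst.
    - exact: cvg_geometric.
  rewrite -[limn _]add0r.
  have -> : (fun t => msiter n y t i k) =
     (fun t => (msiter n y t i k - msiter n y t 0 k) + msiter n y t 0 k).
    by apply/funext => t; rewrite subrK.
  exact: cvgD.
split=> // t B' h k.
have hc : `|msiter n y t 0 k| @[t --> \oo] --> `|limn (fun t => msiter n y t 0 k)|.
  exact: (cvg_norm (cvi 0%N k n0)).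
rewrite -(cvg_lim _ hc)//; apply: limr_le; first by apply/cvg_ex; eexists; exact: hc.
near=> s; rewrite -(@subnK t s); last by near: s; exact: nbhs_infty_ge.
by apply: msiter_norm_le => // j jn; exact: h.
Unshelve. all: by end_near. Qed.
End mean_shift.

(** * Comparison with the population dynamics *)

Section estimates.
Context {R : realType} {p : nat}.
Implicit Types (u v g : 'I_p -> R) (y z w : nat -> 'I_p -> R) (n : nat).

Definition gsum n y v : R := \sum_(j < n) gk (fun k => v k - y j k).

Lemma gk_ratio (D e : R) u v : 0 <= e ->
  (forall k, `|u k - v k| <= 2 * e) -> (forall k, `|u k + v k| <= 4 * D) ->
  gk u <= expR (4 * p%:R * e * D) * gk v.
Proof.
move=> e0 uv1 uv2; rewrite /gk -expRD ler_expR !mulNr -lerBlDr opprK addrC -mulrBl.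
rewrite ler_pdivrMr// -sumrB.
apply: (@le_trans _ _ (\sum_(k < p) (2 * e) * (4 * D))).
  apply: ler_sum => k _.
  have -> : v k ^+ 2 - u k ^+ 2 = - ((u k - v k) * (u k + v k)) by ring.
  by apply: le_trans (ler_norm _) _; rewrite normrN normrM ler_pM.
rewrite sumr_const card_ord -[leLHS]mulr_natl le_eqVlt; apply/orP; left; apply/eqP; ring.
Qed.

(** All weights may be tiny, so they are compared relatively: [|G - H| <= G * (8 p e D)] survives
    division by their sum [S]. Centring at [M], where the [H]-weighted sum vanishes, leaves a single
    sum to bound. *)
Lemma msmean_perturb n y z u v k (D e : R) : (0 < n)%N -> 0 <= e ->
  (forall j k, (j < n)%N -> `|y j k| <= D) -> (forall j k, (j < n)%N -> `|z j k| <= D) ->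
  (forall k, `|u k| <= D) -> (forall k, `|v k| <= D) ->
  (forall j k, (j < n)%N -> `|z j k - y j k| <= e) -> (forall k, `|v k - u k| <= e) ->
  4 * p%:R * e * D <= 2^-1 ->
  `|msmean n z v k - msmean n y u k| <= (1 + 16 * p%:R * D ^+ 2) * e.
Proof.
move=> n0 e0 yD zD uD vD zy vu eps.
set M := msmean n y u k; set S := gsum n z v.
have D0 : 0 <= D by exact: le_trans (uD k).
have S0 : 0 < S by exact: sum_gk_gt0.
pose G j := gk (fun k => v k - z j k); pose H j := gk (fun k => u k - y j k).
have GH j : (j < n)%N -> `|G j - H j| <= G j * (8 * p%:R * e * D).
  move=> jn.
  have d k' : `|(v k' - z j k') - (u k' - y j k')| <= 2 * e.
    have -> : (v k' - z j k') - (u k' - y j k') = (v k' - u k') - (z j k' - y j k') by ring.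
    by rewrite mulrDl !mul1r (le_trans (ler_normB _ _))// lerD// zy.
  have s k' : `|(v k' - z j k') + (u k' - y j k')| <= 4 * D.
    apply: (le_trans (ler_normD _ _)).
    have -> : 4 * D = (D + D) + (D + D) by ring.
    by apply: lerD; apply: (le_trans (ler_normB _ _)); apply: lerD => //; [exact: zD|exact: yD].
  have h1 := gk_ratio e0 d s.
  have h2 : H j <= expR (4 * p%:R * e * D) * G j.
    apply: gk_ratio => // k'; first by rewrite distrC.
    by rewrite addrC.
  have x0 : 0 <= 4 * p%:R * e * D.
    by apply: mulr_ge0 => //; apply: mulr_ge0 => //; exact: mulr_ge0.
  move: h1 h2; rewrite -/(G j) -/(H j).
  set x := 4 * p%:R * e * D in x0 eps *.
  have ex : expR x <= 1 + 2 * x.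
    have := @expR_le1DxDsqr _ x; rewrite ger0_norm// => /(_ eps) /le_trans; apply.
    have : x * x <= 1 * x by rewrite ler_wpM2r//; lra.
    by rewrite expr2; lra.
  have -> : 8 * p%:R * e * D = 2 * x by rewrite /x; ring.
  have G0 : 0 <= G j by exact/ltW/gk_gt0.
  have H0 : 0 <= H j by exact/ltW/gk_gt0.
  move=> h1 h2.
  have h2' : H j <= (1 + 2 * x) * G j by apply: (le_trans h2); rewrite ler_wpM2r.
  have h1' : G j * expR (- x) <= H j.
    by rewrite expRN ler_pdivrMr ?expR_gt0// mulrC.
  have ex' : 1 - x <= expR (- x) by exact: expR_ge1Dx.
  have h3 : G j * (1 - x) <= H j by apply: le_trans h1'; rewrite ler_wpM2l.
  have gx : 0 <= G j * x by rewrite mulr_ge0.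
  by rewrite ler_norml; apply/andP; split; lra.
have SM : S * msmean n z v k = \sum_(j < n) G j * z j k by exact: msmeanE.
have HM : \sum_(j < n) H j * (y j k - M) = 0.
  under eq_bigr do rewrite mulrBr.
  by rewrite sumrB -mulr_suml -msmeanE// subrr.
have MD : `|M| <= D by apply: msmean_norm_le => // j jn; exact: yD.
rewrite -(ler_pM2l S0) -[X in X * `|_|](gtr0_norm S0) -normrM.
have -> : S * (msmean n z v k - M) =
    \sum_(j < n) (G j * (z j k - y j k) + (G j - H j) * (y j k - M)).
  transitivity (\sum_(j < n) (G j * z j k - G j * M) - \sum_(j < n) H j * (y j k - M)).
    by rewrite HM subr0 mulrBr SM sumrB -mulr_suml.
  by rewrite -sumrB; apply: eq_bigr => j _; ring.
apply: (le_trans (ler_norm_sum _ _ _)).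
rewrite /S /gsum mulr_suml; apply: ler_sum => j _; rewrite -/(G j).
have G0 : 0 <= G j by exact/ltW/gk_gt0.
apply: (le_trans (ler_normD _ _)).
have -> : G j * ((1 + 16 * p%:R * D ^+ 2) * e) =
   G j * e + G j * (8 * p%:R * e * D) * (D + D) by ring.
apply: lerD; rewrite normrM.
  by rewrite (ger0_norm G0) ler_wpM2l// zy.
apply: ler_pM => //; first exact: GH.
by apply: (le_trans (ler_normB _ _)); apply: lerD => //; exact: yD.
Qed.

Definition shift v k (h : R) : 'I_p -> R := fun l => v l + (if l == k then h else 0).

Lemma shift0 v k : shift v k 0 = v.
Proof. by apply/funext => l; rewrite /shift if_same addr0. Qed.

Lemma gk_shift u v k h : gk (fun l => shift v k h l - u l) =
  gk (fun l => v l - u l) * expR (h * u k) / expR (h * v k + h ^+ 2 / 2).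
Proof.
rewrite /gk -expRD -expRB; congr expR.
rewrite (bigD1 k)//= [in RHS](bigD1 k)//= /shift eqxx.
rewrite (eq_bigr (fun i => (v i - u i) ^+ 2)); last by move=> i /negbTE ->; rewrite addr0.
by field.
Qed.

(* [exp (v_k h) gsum (v + h e_k)] is log-convex in [h]; this is the tangent
   inequality at [h = 0], so that bounds on [gsum] bound its log-derivative. *)
Lemma msmean_tangent n y v k h : (0 < n)%N ->
  gsum n y v * (1 + h * msmean n y v k) <=
  expR (h * v k + h ^+ 2 / 2) * gsum n y (shift v k h).
Proof.
move=> n0; rewrite mulrDr mulr1 mulrCA msmeanE// /gsum mulr_sumr -big_split/= mulr_sumr.
apply: ler_sum => j _; rewrite gk_shift [leRHS]mulrC divfK ?gt_eqF ?expR_gt0//.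
have := ler_wpM2l (ltW (gk_gt0 (fun l => v l - y j l))) (expR_ge1Dx (h * y j k)).
by apply: le_trans; rewrite mulrDr mulr1 [h * (_ * _)]mulrCA.
Qed.

(** The expectation of [gsum] at [v] for samples [a k * w j k] with standard Gaussian [w j]: [n]
    times the convolution of the kernel with a normal law of deviations [a k]. *)
Definition gmean n (a : 'I_p -> R) v : R :=
  n%:R * \prod_k ((Num.sqrt (1 + a k ^+ 2))^-1 * expR (- (v k ^+ 2) / (2 * (1 + a k ^+ 2)))).

Definition kappa (a : 'I_p -> R) k : R := a k ^+ 2 / (1 + a k ^+ 2).

Lemma kappa_ge0 a k : 0 <= kappa a k.
Proof. by rewrite /kappa divr_ge0 ?sqr_ge0// addr_ge0// sqr_ge0. Qed.

Lemma kappa_le1 a k : kappa a k <= 1.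
Proof.
have := sqr_ge0 (a k) => h; rewrite /kappa ler_pdivrMr; lra.
Qed.

Lemma gmean_gt0 n a v : (0 < n)%N -> 0 < gmean n a v.
Proof.
move=> n0; rewrite /gmean mulr_gt0 ?ltr0n// prodr_gt0// => k _.
by rewrite mulr_gt0 ?expR_gt0// invr_gt0 sqrtr_gt0 ltr_pwDl// sqr_ge0.
Qed.

(** The exact counterpart of [msmean_tangent] for the mean: the logarithm of the tilted mean is
    quadratic in [h], and its slope at [0] is the population mean shift [kappa a k * v k]. *)
Lemma gmean_shift n a v k h :
  expR (h * v k + h ^+ 2 / 2) * gmean n a (shift v k h) =
  gmean n a v * expR (kappa a k * (h * v k + h ^+ 2 / 2)).
Proof.
rewrite /gmean mulrCA -[RHS]mulrA; congr (_ * _).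
rewrite (bigD1 k)//= [in RHS](bigD1 k)//= /shift eqxx.
rewrite [in LHS](eq_bigr (fun k => (Num.sqrt (1 + a k ^+ 2))^-1 *
   expR (- (v k ^+ 2) / (2 * (1 + a k ^+ 2))))); last first.
  by move=> i /negbTE ->; rewrite addr0.
set Q := \prod_(i | _) _; rewrite mulrA [RHS]mulrAC; congr (_ * _).
rewrite mulrCA -[RHS]mulrA; congr (_ * _); rewrite -!expRD; congr expR.
have := sqr_ge0 (a k) => h0.
have h1 : 1 + a k ^+ 2 != 0 by rewrite gt_eqF//; lra.
by rewrite /kappa; field.
Qed.

(** The tangent inequality at [s = h] and [s = - h] traps [msmean] between two difference quotients,
    so three values of [gsum] suffice and the numerator needs no concentration of its own. Curvature
    costs a multiple of [h * D ^ 2], and the relative error [del] is divided by [h]. *)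
Lemma msmean_gmean n y a g k (D h del : R) : (0 < n)%N -> 1 <= D ->
  `|g k| <= D -> 0 < h -> h * D <= 4^-1 -> 0 <= del <= 2^-1 ->
  (forall s : R, s \in [:: 0; h; - h] ->
    `|gsum n y (shift g k s) - gmean n a (shift g k s)| <= del * gmean n a (shift g k s)) ->
  `|msmean n y g k - kappa a k * g k| <= 5 * h * D ^+ 2 + 8 * del / h.
Proof.
move=> n0 D1 gD h0 hD /andP[d0 d1] hS.
have D0 : 0 < D by lra.
have h1 : h <= 4^-1 by apply: le_trans hD; rewrite ler_peMr// ltW.
have key (s : R) : s \in [:: h; - h] ->
    s * (msmean n y g k - kappa a k * g k) <= 5 * h ^+ 2 * D ^+ 2 + 8 * del.
  move=> sh; have sn : `|s| = h.
    by move: sh; rewrite !inE => /orP[]/eqP->; rewrite ?normrN gtr0_norm.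
  have s2 : s ^+ 2 = h ^+ 2 by rewrite -sn real_normK ?num_real.
  have G0 := gmean_gt0 a g n0; have Gs := gmean_gt0 a (shift g k s) n0.
  have := hS 0 (mem_head _ _); rewrite shift0 ler_norml => /andP[low _].
  have := hS s; rewrite inE sh orbT => /(_ isT); rewrite ler_norml => /andP[_ up].
  have T := @msmean_tangent n y g k s n0.
  set M := msmean n y g k in T *; set kp := kappa a k.
  set E := expR _ in T.
  have E0 : 0 < E by exact: expR_gt0.
  have : gsum n y g * (1 + s * M) <= (1 + del) * (gmean n a g * expR (kp * (s * g k + s ^+ 2 / 2))).
    apply: (le_trans T); rewrite -gmean_shift -/E mulrCA ler_pM2l//; lra.
  set u := kp * _; move=> T2.
  have kp0 : 0 <= kp := kappa_ge0 a k; have kp1 : kp <= 1 := kappa_le1 a k.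
  have sg : `|s * g k| <= h * D by rewrite normrM sn ler_wpM2l// ltW.
  have hh : h ^+ 2 <= h * D by rewrite expr2 ler_pM2l//; lra.
  have ub : `|s * g k + s ^+ 2 / 2| <= 2 * (h * D).
    apply: (le_trans (ler_normD _ _)); rewrite s2 (ger0_norm (_ : 0 <= h ^+ 2 / 2)) ?divr_ge0 ?sqr_ge0//.
    have := sqr_ge0 h; lra.
  have un : `|u| <= 2 * (h * D).
    rewrite /u normrM (ger0_norm kp0); apply: le_trans ub; rewrite ler_piMl//.
  have eu : expR u <= 1 + u + u ^+ 2 by apply: expR_le1DxDsqr; lra.
  have u2 : u ^+ 2 <= (2 * (h * D)) ^+ 2.
    by rewrite -real_normK ?num_real// lerXn2r ?nnegrE// mulr_ge0// mulr_ge0// ltW.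
  have eu2 : expR u <= 2.
    have u1 : `|u| <= 2^-1 by lra.
    have : u ^+ 2 <= 2^-1 ^+ 2 by rewrite -real_normK ?num_real// lerXn2r ?nnegrE.
    move: u1; rewrite ler_norml => /andP[]; lra.
  have eu0 := expR_gt0 u.
  (* The lower bound on [gsum n y g] may be multiplied by [1 + s * M] only if this is nonnegative;
     otherwise the claim is immediate. *)
  have neg : 1 + s * M <= 0 \/ 0 <= 1 + s * M by lra.
  have res : 1 + s * M <= (1 + 4 * del) * expR u.
    case: neg => [ng|pg]; first by apply: (le_trans ng); rewrite mulr_ge0// ltW//; lra.
    have T3 : (1 - del) * (1 + s * M) <= (1 + del) * expR u.
      rewrite -(ler_pM2l G0) [leRHS]mulrCA; apply: le_trans T2.
      by rewrite mulrA ler_wpM2r//; lra.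
    have dd : (1 + del) * expR u <= (1 - del) * ((1 + 4 * del) * expR u).
      rewrite mulrA ler_pM2r//.
      have : del * del <= 2^-1 * del by rewrite ler_wpM2r.
      lra.
    have := le_trans T3 dd; rewrite ler_pM2l//; lra.
  have : s * M <= u + u ^+ 2 + 8 * del.
    have : del * expR u <= del * 2 by rewrite ler_wpM2l.
    lra.
  have us : u <= kp * (s * g k) + h ^+ 2 / 2.
    rewrite /u mulrDr lerD2l s2 ler_piMl// divr_ge0// sqr_ge0//.
  have hD2 : h ^+ 2 / 2 <= h ^+ 2 * D ^+ 2.
    rewrite ler_pM2l ?exprn_gt0//; have : 1 <= D ^+ 2 by rewrite exprn_ege1.
    lra.
  have -> : s * (M - kp * g k) = s * M - kp * (s * g k) by ring.
  have E2 : (2 * (h * D)) ^+ 2 = 4 * (h ^+ 2 * D ^+ 2) by ring.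
  rewrite E2 in u2; lra.
have := key h; rewrite mem_head => /(_ isT) kh.
have := key (- h); rewrite inE mem_head orbT => /(_ isT) knh.
have -> : 5 * h * D ^+ 2 + 8 * del / h = h^-1 * (5 * h ^+ 2 * D ^+ 2 + 8 * del).
  by field; rewrite gt_eqF.
rewrite ler_pdivlMl// -[X in X * _](gtr0_norm h0) -normrM ler_norml.
by apply/andP; split; lra.
Qed.

Fixpoint alpha (s : 'I_p -> R) (t : nat) (k : 'I_p) : R :=
  if t is t'.+1 then kappa (alpha s t') k * alpha s t' k else s k.

Lemma alpha_ge0 s t k : (forall k, 0 <= s k) -> 0 <= alpha s t k.
Proof. by move=> s0; elim: t => [|t IH] //=; rewrite mulr_ge0// kappa_ge0. Qed.

Lemma kappa_mono (a b : 'I_p -> R) k l : 0 <= a k <= b l -> kappa a k <= kappa b l.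
Proof.
move=> /andP[a0 ab]; rewrite /kappa.
have h : a k ^+ 2 <= b l ^+ 2 by rewrite lerXn2r ?nnegrE//; exact: le_trans ab.
have h0 := sqr_ge0 (a k).
rewrite ler_pdivrMr; last lra.
rewrite mulrAC ler_pdivlMr; last lra.
by rewrite !mulrDr !mulr1 (mulrC (b l ^+ 2)) lerD2r.
Qed.

Lemma alpha_decr s t k : (forall k, 0 <= s k) -> alpha s t k <= s k.
Proof.
move=> s0; elim: t => [|t IH] //=; apply: le_trans IH.
by rewrite ler_piMl ?kappa_le1// alpha_ge0.
Qed.

Lemma alpha_le s t k (b : R) : (forall k, 0 <= s k <= b) ->
  alpha s t k <= (b ^+ 2 / (1 + b ^+ 2)) ^+ t * s k.
Proof.
move=> sb; have s0 j : 0 <= s j by case/andP: (sb j).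
elim: t => [|t IH] /=; first by rewrite mul1r.
rewrite exprS -mulrA; apply: ler_pM => //; [exact: kappa_ge0|exact: alpha_ge0|].
apply: (@kappa_mono _ (fun=> b) k k); rewrite alpha_ge0//=.
by rewrite (le_trans (alpha_decr _ _ s0))//; case/andP: (sb k).
Qed.

(* [A] and [eta] are the growth factor and the one-step defect of the
   deviation from the linear dynamics [z |-> alpha t z]. *)
Lemma msiter_linear n w s (T : nat) (D m h del A eta : R) : (0 < n)%N ->
  1 <= D -> 0 <= m <= 1 -> 0 < h -> h * (D + 1) <= 4^-1 -> 0 <= del <= 2^-1 ->
  (forall k, 0 <= s k) ->
  (forall j k, (j < n)%N -> `|s k * w j k| <= D) ->
  A = 2 + 16 * p%:R * (D + 1) ^+ 2 ->
  eta = A * m + m + (5 * h * (D + 1) ^+ 2 + 8 * del / h) ->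
  8 * p%:R * (D + 1) * (A ^+ T * eta) <= 2^-1 -> A ^+ T * eta <= 1 ->
  (forall t i, (t < T)%N -> (i < n)%N -> exists g : 'I_p -> R,
    (forall k, `|g k - alpha s t k * w i k| <= m) /\
    (forall k (e : R), e \in [:: 0; h; - h] ->
      `|gsum n (fun j k => alpha s t k * w j k) (shift g k e) -
        gmean n (alpha s t) (shift g k e)| <= del * gmean n (alpha s t) (shift g k e))) ->
  forall t i k, (t <= T)%N -> (i < n)%N ->
  `|msiter n (fun j k => s k * w j k) t i k - alpha s t k * w i k| <= A ^+ t * eta.
Proof.
move=> n0 D1 /andP[m0 m1] h0 hD dd s0 wD AE etaE small small1 good.
have D0 : 0 <= D by lra.
have A1 : 1 <= A.
  rewrite AE; have : 0 <= 16 * p%:R * (D + 1) ^+ 2 by apply: mulr_ge0; [exact: mulr_ge0|exact: sqr_ge0].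
  lra.
have err0 : 0 <= 5 * h * (D + 1) ^+ 2 + 8 * del / h.
  case/andP: dd => d0 _; apply: addr_ge0.
    by apply: mulr_ge0; [apply: mulr_ge0 => //; exact: ltW|exact: sqr_ge0].
  by apply: divr_ge0; [exact: mulr_ge0|exact: ltW].
have Am : 0 <= A * m by rewrite mulr_ge0//; lra.
have eta0 : 0 <= eta by rewrite etaE; lra.
have meta : m <= eta by rewrite etaE; lra.
have zD t j k : (j < n)%N -> `|msiter n (fun j k => s k * w j k) t j k| <= D.
  by move=> jn; rewrite -[t]addn0; apply: msiter_norm_le => // i; exact: wD.
have yD t j k : (j < n)%N -> `|alpha s t k * w j k| <= D.
  move=> jn; apply: le_trans (wD j k jn); rewrite !normrM ler_wpM2r//.
  by rewrite !ger0_norm ?alpha_ge0// alpha_decr.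
elim=> [|t IH] i k tT iN; first by rewrite /msiter/= subrr normr0 mul1r.
have {}IH j l (jn : (j < n)%N) := IH j l (ltnW tT) jn.
have [g [gm gS]] := good t i tT iN.
set e := A ^+ t * eta in IH.
have AtT : A ^+ t <= A ^+ T by rewrite ler_weXn2l// ltnW.
have e0 : 0 <= e by rewrite mulr_ge0// exprn_ge0//; lra.
have em : e <= A ^+ T * eta by rewrite ler_wpM2r.
have mem : m <= A ^+ T * eta.
  by apply: (le_trans meta); rewrite ler_peMl// exprn_ege1.
rewrite /msiter iterS -/(msiter _ _ _) /msstep /=.
set z := msiter n _ t; set y := fun j k => alpha s t k * w j k.
have gD l : `|g l| <= D + 1.
  rewrite -[g l](subrK (alpha s t l * w i l)) (le_trans (ler_normD _ _))// addrC lerD//.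
    exact: yD.
  exact: le_trans (gm l) m1.
(* [P1] passes from the iterates to the linear dynamics and from sample [i] to the test point [g],
   [P2] is concentration at [g], and [P3] returns from [g] to the sample. *)
have P1 : `|msmean n z (z i) k - msmean n y g k| <= (1 + 16 * p%:R * (D + 1) ^+ 2) * (e + m).
  apply: msmean_perturb => //.
  - by rewrite addr_ge0.
  - by move=> j l jn; apply: le_trans (yD t j l jn) _; lra.
  - by move=> j l jn; apply: le_trans (zD t j l jn) _; lra.
  - by move=> l; apply: le_trans (zD t i l iN) _; lra.
  - by move=> j l jn; apply: le_trans (IH j l jn) _; lra.
  - move=> l; have -> : z i l - g l = (z i l - alpha s t l * w i l) - (g l - alpha s t l * w i l) by ring.
    by apply: (le_trans (ler_normB _ _)); apply: lerD => //; exact: IH.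
  - apply: le_trans small; rewrite mulrAC.
    have -> : 8 * p%:R * (D + 1) * (A ^+ T * eta) =
      4 * p%:R * (D + 1) * (A ^+ T * eta + A ^+ T * eta) by ring.
    rewrite ler_wpM2l//; last exact: lerD.
    by apply: mulr_ge0; [exact: mulr_ge0|lra].
have P2 : `|msmean n y g k - kappa (alpha s t) k * g k| <= 5 * h * (D + 1) ^+ 2 + 8 * del / h.
  apply: msmean_gmean => //; first lra.
  exact: gS.
have P3 : `|kappa (alpha s t) k * g k - kappa (alpha s t) k * alpha s t k * w i k| <= m.
  rewrite -mulrA -mulrBr normrM (ger0_norm (kappa_ge0 _ _)).
  by apply: le_trans (gm k); rewrite ler_piMl// kappa_le1.
set a1 := msmean n z (z i) k in P1 *; set a2 := msmean n y g k in P1 P2.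
set a3 := kappa (alpha s t) k * g k in P2 P3; set a4 := _ * w i k in P3 *.
have -> : a1 - a4 = (a1 - a2) + (a2 - a3) + (a3 - a4) by ring.
apply: (le_trans (ler_normD _ _)).
have h12 : `|(a1 - a2) + (a2 - a3)| <= (1 + 16 * p%:R * (D + 1) ^+ 2) * (e + m) + (5 * h * (D + 1) ^+ 2 + 8 * del / h).
  by apply: (le_trans (ler_normD _ _)); exact: lerD.
have -> : A ^+ t.+1 * eta = A * e by rewrite exprS -mulrA.
have eeta : eta <= e by rewrite /e ler_peMl// exprn_ege1.
(* The Lipschitz factor is [A - 1], so a spare [- e] remains; it pays for all one-step defects
   because [eta <= e]. *)
have A2 : (1 + 16 * p%:R * (D + 1) ^+ 2) = A - 1 by rewrite AE; ring.
rewrite A2 in h12.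
have : (A - 1) * (e + m) = A * e + A * m - e - m by ring.
lra.
Qed.

End estimates.

(** * Growth of the error over the iterations *)

Section asymptotics.
Context {R : realType}.

Lemma expR_ge_id (x : R) : x <= expR x.
Proof. by apply: le_trans (expR_ge1Dx x); rewrite lerDr. Qed.

Lemma expR_ge_sqr (x : R) : 0 <= x -> x ^+ 2 / 2 <= expR x.
Proof.
move=> x0; have := @expR_ge1Dxn R x 1 x0; rewrite (_ : 2`! = 2)%N//.
by apply: le_trans; rewrite lerDr.
Qed.

(* The logarithmic error accumulated over [r^2 ~ sqrt (ln n)] steps is
   [O(r^3)], negligible against the gain [b r^4 = b ln n]. *)
Lemma error_small (p : nat) (c b : R) : 1 <= c -> 0 < b <= 1 ->
  exists2 r0 : R, 2 <= r0 & forall (r : R) (T : nat), r0 <= r -> T%:R <= r ^+ 2 ->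
  let D := c * r ^+ 2 in let A := 2 + 16 * p%:R * (D + 1) ^+ 2 in
  let m := expR (- r ^+ 4) in let h := expR (- (b * r ^+ 4)) in
  let del := expR (- (2 * b * r ^+ 4)) in
  let eta := A * m + m + (5 * h * (D + 1) ^+ 2 + 8 * del / h) in
  (8 * p%:R * (D + 1) + 1) * (A ^+ T * eta) <= expR (- r) /\
  h * (D + 1) <= 4^-1 /\ del <= 2^-1 /\ m <= h.
Proof.
move=> c1 /andP[b0 b1].
(* [K1], [K2], [K3] bound [A], [eta] and the final prefactor in units of [r ^ 4], [r ^ 4 * h] and
   [r ^ 2]; [K4] collects what [b * r ^ 4] has to beat at order [r ^ 3]. *)
pose K1 : R := 2 + 64 * p%:R * c ^+ 2.
pose K2 : R := K1 + 1 + 20 * c ^+ 2 + 8.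
pose K3 : R := 16 * p%:R * c + 1.
pose K4 : R := K1 + K2 + K3 + 2 * c + 10.
have p0 : 0 <= p%:R :> R by [].
have c2 : 1 <= c ^+ 2 by rewrite exprn_ege1.
have pc : 0 <= p%:R * c ^+ 2 by apply: mulr_ge0 => //; lra.
have pc1 : 0 <= p%:R * c by apply: mulr_ge0 => //; lra.
have K10 : 0 <= K1 by rewrite /K1; lra.
have K20 : 0 <= K2 by rewrite /K2; lra.
have K30 : 0 <= K3 by rewrite /K3; lra.
exists (Num.max 2 ((K4 + 2) / b)); first by rewrite le_max lexx.
move=> r T; rewrite ge_max => /andP[r2 rK] Tr D A m h del eta.
have r0 : 0 < r by lra.
have r1 : 1 <= r by lra.
have rr1 : 1 <= r ^+ 2 by rewrite exprn_ege1.
have rr3 : 1 <= r ^+ 3 by rewrite exprn_ege1.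
have rr4 : 1 <= r ^+ 4 by rewrite exprn_ege1.
have rle3 : r <= r ^+ 3 by rewrite -[leLHS]expr1 ler_weXn2l.
have r2le3 : r ^+ 2 <= r ^+ 3 by rewrite ler_weXn2l.
have bigr : (K4 + 2) * r ^+ 3 <= b * r ^+ 4.
  have : K4 + 2 <= b * r by rewrite mulrC -ler_pdivrMr.
  move=> h1; have -> : b * r ^+ 4 = (b * r) * r ^+ 3 by ring.
  by rewrite ler_wpM2r// exprn_ge0// ltW.
have D1 : D + 1 <= 2 * c * r ^+ 2.
  have : 1 * 1 <= c * r ^+ 2 by apply: ler_pM.
  rewrite /D; lra.
have D0 : 0 <= D + 1 by rewrite /D addr_ge0// mulr_ge0 ?sqr_ge0//; lra.
have DD : (D + 1) ^+ 2 <= 4 * c ^+ 2 * r ^+ 4.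
  have -> : 4 * c ^+ 2 * r ^+ 4 = (2 * c * r ^+ 2) ^+ 2 by ring.
  by rewrite lerXn2r ?nnegrE//; exact: le_trans D1.
have AK : A <= K1 * r ^+ 4.
  have : p%:R * (D + 1) ^+ 2 <= p%:R * (4 * c ^+ 2 * r ^+ 4) by rewrite ler_wpM2l.
  rewrite /A /K1; lra.
have A0 : 0 <= A.
  by rewrite /A addr_ge0//; apply: mulr_ge0; [exact: mulr_ge0|exact: sqr_ge0].
have h0 : 0 < h by exact: expR_gt0.
have mh : m <= h by rewrite /m /h ler_expR lerN2 ler_piMl// ltW//; lra.
have m0 : 0 < m by exact: expR_gt0.
(* [del = h ^ 2], so the finite-difference error is again of order [h]. *)
have dh : del / h = h by rewrite /del /h -expRB; congr expR; ring.
have etaK : eta <= K2 * r ^+ 4 * h.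
  rewrite /eta -[8 * del / h]mulrA dh.
  have : A * m <= K1 * r ^+ 4 * h by apply: ler_pM => //; exact: ltW.
  have : h * (D + 1) ^+ 2 <= h * (4 * c ^+ 2 * r ^+ 4) by rewrite ler_wpM2l// ltW.
  have : 1 * h <= r ^+ 4 * h by rewrite ler_wpM2r// ltW.
  rewrite /K2; lra.
have eta0 : 0 <= eta.
  rewrite /eta -[8 * del / h]mulrA dh.
  have : 0 <= A * m by rewrite mulr_ge0// ltW.
  have : 0 <= h * (D + 1) ^+ 2 by rewrite mulr_ge0 ?sqr_ge0// ltW.
  lra.
have rE : r <= expR r by exact: expR_ge_id.
have rnE n : r ^+ n <= expR (r * n%:R).
  by rewrite expRM_natr lerXn2r ?nnegrE ?expR_ge0// ltW.
have KE (K : R) : K <= expR K by exact: expR_ge_id.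
have kr (K : R) n : 0 <= K -> K * r ^+ n <= expR (K + r * n%:R).
  by move=> K0; rewrite expRD; apply: ler_pM => //; rewrite exprn_ge0// ltW.
split; [|split; [|split]] => //.
- have AT : A ^+ T <= expR ((K1 + r * 4) * r ^+ 2).
    apply: (@le_trans _ _ (expR (K1 + r * 4) ^+ T)).
      rewrite lerXn2r ?nnegrE ?expR_ge0//; apply: (le_trans AK); exact: kr.
    by rewrite -expRM_natr ler_expR ler_wpM2l// addr_ge0// mulr_ge0// ltW.
  have etaE : eta <= expR (K2 + r * 4 - b * r ^+ 4).
    rewrite expRB -/h -expRN; apply: (le_trans etaK); rewrite /h.
    by rewrite ler_wpM2r ?expR_ge0//; exact: kr.
  have pE : 8 * p%:R * (D + 1) + 1 <= expR (K3 + r * 2).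
    apply: le_trans (kr K3 2 K30).
    have : p%:R * (D + 1) <= p%:R * (2 * c * r ^+ 2) by rewrite ler_wpM2l.
    rewrite /K3; lra.
  apply: (@le_trans _ _ (expR (K3 + r * 2) *
    (expR ((K1 + r * 4) * r ^+ 2) * expR (K2 + r * 4 - b * r ^+ 4)))).
    apply: ler_pM => //; first by rewrite addr_ge0// mulr_ge0// mulr_ge0.
      by rewrite mulr_ge0// exprn_ge0.
    by apply: ler_pM => //; rewrite exprn_ge0.
  rewrite -!expRD ler_expR.
  have -> : (K1 + r * 4) * r ^+ 2 = K1 * r ^+ 2 + 4 * r ^+ 3 by ring.
  have h1 : K1 * r ^+ 2 <= K1 * r ^+ 3 by rewrite ler_wpM2l.
  have h2 : K2 * 1 <= K2 * r ^+ 3 by rewrite ler_wpM2l.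
  have h3 : K3 * 1 <= K3 * r ^+ 3 by rewrite ler_wpM2l.
  have h4 : c * 1 <= c * r ^+ 3 by rewrite ler_wpM2l//; lra.
  rewrite /K4 in bigr; lra.
- have : D + 1 <= expR (2 * c + r * 2).
    by apply: (le_trans D1); apply: kr; lra.
  move=> h1; apply: (@le_trans _ _ (expR (- (b * r ^+ 4)) * expR (2 * c + r * 2))).
    by rewrite ler_wpM2l ?expR_ge0.
  rewrite -expRD; apply: (@le_trans _ _ (expR (- 3))).
    rewrite ler_expR.
    have h2 : (K1 + K2 + K3) * 1 <= (K1 + K2 + K3) * r ^+ 3 by rewrite ler_wpM2l//; lra.
    have h4 : c * 1 <= c * r ^+ 3 by rewrite ler_wpM2l//; lra.
    rewrite /K4 in bigr; lra.
  rewrite expRN invf_ple ?posrE ?expR_gt0//.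
  by have := expR_ge1Dx (3 : R); lra.
- apply: (@le_trans _ _ (expR (- 1))).
    rewrite /del ler_expR.
    have h2 : (K1 + K2 + K3) * 1 <= (K1 + K2 + K3) * r ^+ 3 by rewrite ler_wpM2l//; lra.
    have h4 : c * 1 <= c * r ^+ 3 by rewrite ler_wpM2l//; lra.
    rewrite /K4 in bigr; lra.
  rewrite expRN invf_ple ?posrE ?expR_gt0//.
  by have := expR_ge1Dx (1 : R); lra.
Qed.

(** With [rho = exp (- q)], the bound [exp (- x) <= 2 / x ^ 2] at [x = q * r ^ 2] gives a decay
    [1 / r ^ 4] against the factor [r ^ 2]. Only [T > r ^ 2 - 1] is known, which costs one factor
    [exp q]. *)
Lemma geometric_small (rho c : R) : 0 < rho < 1 -> 1 <= c ->
  exists2 C : R, 0 <= C & forall (r : R) (T : nat), 1 <= r -> r ^+ 2 < T.+1%:R ->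
   rho ^+ T * (c * r ^+ 2) <= C / r.
Proof.
move=> /andP[rho0 rho1] c1.
pose q := - ln rho.
have q0 : 0 < q by rewrite /q oppr_gt0 ln_lt0// rho0.
have rhoE : rho = expR (- q) by rewrite /q opprK lnK.
exists (2 * c * expR q / q ^+ 2).
  by rewrite divr_ge0 ?sqr_ge0// mulr_ge0 ?expR_ge0//; lra.
move=> r T r1 rT.
have r0 : 0 < r by lra.
have rr : 0 < r ^+ 2 by rewrite exprn_gt0.
have h1 : rho ^+ T <= expR q * expR (- (q * r ^+ 2)).
  rewrite rhoE -expRM_natr -expRD ler_expR.
  have : q * r ^+ 2 <= q * T.+1%:R by rewrite ler_pM2l// ltW.
  by rewrite -natr1; lra.
have h2 : expR (- (q * r ^+ 2)) <= 2 / (q ^+ 2 * r ^+ 4).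
  rewrite expRN -invf_div lef_pV2 ?posrE ?expR_gt0 ?divr_gt0 ?mulr_gt0 ?exprn_gt0//.
  have q20 : 0 <= q * r ^+ 2 by rewrite mulr_ge0// ltW.
  have := expR_ge_sqr q20.
  by rewrite (_ : (q * r ^+ 2) ^+ 2 = q ^+ 2 * r ^+ 4)//; ring.
apply: (@le_trans _ _ (expR q * (2 / (q ^+ 2 * r ^+ 4)) * (c * r ^+ 2))).
  apply: ler_wpM2r; first by apply: mulr_ge0; [lra|exact: sqr_ge0].
  by apply: (le_trans h1); rewrite ler_wpM2l ?expR_ge0.
have -> : expR q * (2 / (q ^+ 2 * r ^+ 4)) * (c * r ^+ 2) =
   (2 * c * expR q / q ^+ 2) * (r ^+ 2)^-1.
  by field; rewrite !gt_eqF.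
rewrite ler_wpM2l//; last by rewrite lef_pV2 ?posrE// -[leLHS]expr1 ler_weXn2l.
by rewrite divr_ge0 ?sqr_ge0// mulr_ge0 ?expR_ge0//; lra.
Qed.

(** The deterministic half: samples enter only through their size and the existence of good test
    points. The two inequalities on [h] come from [error_small] and are offered to the latter
    hypothesis, since locating a test point requires them. *)
Lemma msiter_small (p : nat) (s : 'I_p -> R) (bs c b : R) : 1 <= bs ->
  (forall k, 0 <= s k <= bs) -> 1 <= c -> 0 < b <= 1 ->
  exists C r0 : R, [/\ 0 <= C, 2 <= r0 & forall (n : nat) (r : R) (w : nat -> 'I_p -> R),
    r0 <= r -> n%:R = expR (r ^+ 4) ->
    let h := expR (- (b * r ^+ 4)) in let del := expR (- (2 * b * r ^+ 4)) in
    (forall j k, (j < n)%N -> `|s k * w j k| <= c * r ^+ 2) ->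
    (h * (c * r ^+ 2 + 1) <= 4^-1 -> n%:R^-1 <= h ->
     forall t i, (t < n)%N -> (i < n)%N -> exists g : 'I_p -> R,
      (forall k, `|g k - alpha s t k * w i k| <= n%:R^-1) /\
      (forall k (e : R), e \in [:: 0; h; - h] ->
      `|gsum n (fun j k => alpha s t k * w j k) (shift g k e) -
        gmean n (alpha s t) (shift g k e)| <= del * gmean n (alpha s t) (shift g k e))) ->
    exists T, forall i k, (i < n)%N -> `|msiter n (fun j k => s k * w j k) T i k| <= C / r].
Proof.
move=> bs1 sb c1 b01.
have s0 k : 0 <= s k by case/andP: (sb k).
pose rho := bs ^+ 2 / (1 + bs ^+ 2).
have bs2 : 1 <= bs ^+ 2 by rewrite exprn_ege1.
have rho01 : 0 < rho < 1.
  by rewrite /rho divr_gt0//=; [rewrite ltr_pdivrMr; lra|lra|lra].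
have [C C0 geo] := geometric_small rho01 c1.
have [r0 r02 err] := @error_small p c b c1 b01.
exists (1 + C), r0; split=> //; first by lra.
move=> n r w rr0 nE h del wD good.
pose T := Num.truncn (r ^+ 2).
have r1 : 2 <= r by lra.
have r20 : 0 <= r ^+ 2 by exact: sqr_ge0.
have TT : T%:R <= r ^+ 2 < T.+1%:R by exact: truncn_itv.
have /andP[Tr rT] := TT.
have [e1 [e2 [e3 e4]]] := err r T rr0 Tr.
rewrite -/h -/del in e1 e2 e3 e4.
have mE : expR (- r ^+ 4) = n%:R^-1 by rewrite expRN nE.
rewrite mE in e1 e4.
have n0 : (0 < n)%N by rewrite -(ltr_nat R) nE expR_gt0.
have nR : 1 <= n%:R :> R by rewrite ler1n.
have Tn : (T <= n)%N.
  rewrite -(ler_nat R) nE; apply: (le_trans Tr); apply: le_trans (expR_ge_id _).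
  by rewrite ler_weXn2l//; lra.
set D := c * r ^+ 2 in wD e1 e2 good.
have D1 : 1 <= D.
  have : 1 * 1 <= c * r ^+ 2 by apply: ler_pM => //; rewrite exprn_ege1//; lra.
  by rewrite mul1r.
set A := 2 + _ in e1; set eta := _ + _ + (_ + _) in e1.
have A0 : 0 <= A.
  by rewrite /A addr_ge0//; apply: mulr_ge0; [exact: mulr_ge0|exact: sqr_ge0].
have h0 : 0 < h by exact: expR_gt0.
have d0 : 0 < del by exact: expR_gt0.
have eta0 : 0 <= eta.
  rewrite /eta; apply: addr_ge0; first by rewrite addr_ge0 ?mulr_ge0 ?invr_ge0.
  apply: addr_ge0; last by rewrite divr_ge0 ?mulr_ge0 ?ltW.
  by apply: mulr_ge0; [apply: mulr_ge0 => //; exact: ltW|exact: sqr_ge0].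
have X0 : 0 <= A ^+ T * eta by rewrite mulr_ge0// exprn_ge0.
have pX : 0 <= 8 * p%:R * (D + 1) * (A ^+ T * eta).
  by apply: mulr_ge0 => //; apply: mulr_ge0; [exact: mulr_ge0|lra].
have er : expR (- r) <= 2^-1 /\ expR (- r) <= r^-1.
  have := expR_ge1Dx r => h1; rewrite expRN !lef_pV2 ?posrE ?expR_gt0//; lra.
have e1' : 8 * p%:R * (D + 1) * (A ^+ T * eta) + A ^+ T * eta <= expR (- r).
  by move: e1; set X := A ^+ T * eta; rewrite mulrDl mul1r.
exists T => i k iN.
have P : `|msiter n (fun j k => s k * w j k) T i k - alpha s T k * w i k| <= A ^+ T * eta.
  apply: (@msiter_linear R p n w s T D n%:R^-1 h del A eta n0 D1) => //.
  - by rewrite invr_ge0 ler0n/= invf_le1//; lra.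
  - by rewrite ltW.
  - case: er; lra.
  - case: er; lra.
  - by move=> t j tT jn; apply: good => //; exact: leq_trans Tn.
have Q : `|alpha s T k * w i k| <= C / r.
  apply: le_trans (geo r T _ rT); last lra.
  rewrite normrM (ger0_norm (alpha_ge0 _ _ s0)).
  apply: (@le_trans _ _ (rho ^+ T * s k * `|w i k|)).
    by rewrite ler_wpM2r//; exact: alpha_le.
  rewrite -mulrA ler_wpM2l ?exprn_ge0//; first by case/andP: rho01 => /ltW.
  by rewrite -[X in X * _](ger0_norm (s0 k)) -normrM; exact: wD.
rewrite -[msiter _ _ _ _ _](subrK (alpha s T k * w i k)).
apply: (le_trans (ler_normD _ _)); rewrite mulrDl mul1r; apply: lerD => //.
case: er; lra.
Qed.
End asymptotics.

(** * Almost sure estimates *)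

Section summability.
Context {R : realType}.

(** A discrete integral test: up to an index shift, the power [- (1 + e)] is dominated by the
    telescoping [(u n - u n.+1) / e], with [u] the power [- e]. *)
Lemma cvg_series_npow (e : R) : 0 < e ->
  cvgn (series (fun n => expR (- ((1 + e) * ln (n.+1%:R : R))))).
Proof.
move=> e0; pose u n : R := expR (- (e * ln (n.+1%:R))).
set v := (X in series X).
have v0 n : 0 <= v n by exact: expR_ge0.
have step n : v n.+1 <= (u n - u n.+1) / e.
  rewrite ler_pdivlMr//.
  have n1 : 0 < n.+1%:R :> R by [].
  have n2 : 0 < n.+2%:R :> R by [].
  have lnd : (n.+2%:R)^-1 <= ln (n.+2%:R) - ln (n.+1%:R) :> R.
    have := @le_ln1Dx R (- (n.+2%:R)^-1); rewrite ltrN2 invf_lt1// ltr1n => /(_ isT).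
    have -> : 1 + - n.+2%:R^-1 = n.+1%:R / n.+2%:R :> R.
      by rewrite -[n.+1%:R](addrK 1) natr1; field; rewrite gt_eqF.
    rewrite ln_div ?posrE//; set x := ln _; set y := ln _; set z := _^-1.
    by lra.
  have uE : u n = u n.+1 * expR (e * (ln (n.+2%:R) - ln (n.+1%:R))).
    by rewrite /u -expRD; congr expR; ring.
  have vE : v n.+1 = u n.+1 * (n.+2%:R)^-1.
    rewrite /v /u mulrDl mul1r opprD expRD mulrC; congr (_ * _).
    by rewrite expRN lnK ?posrE.
  have un : 0 <= u n.+1 by exact: expR_ge0.
  rewrite vE uE -[X in _ <= _ - X]mulr1 -mulrBr -mulrA ler_wpM2l//.
  have := expR_ge1Dx (e * (ln (n.+2%:R) - ln (n.+1%:R)) : R).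
  have : e * (n.+2%:R)^-1 <= e * (ln (n.+2%:R) - ln (n.+1%:R)) by rewrite ler_wpM2l// ltW.
  set z := _^-1; set y := ln _ - _ => h1 h2; rewrite mulrC; move: h1 h2; rewrite /z; set a := e * _; set g := e * _; lra.
apply: nondecreasing_is_cvgn.
  by apply/nondecreasing_seqP => n; rewrite seriesSr lerDl.
have bd n : series v n.+1 <= v 0 + (u 0 - u n) / e.
  elim: n => [|n IH]; first by rewrite /series/= big_nat1 subrr mul0r addr0.
  rewrite seriesSr; apply: (le_trans (lerD IH (step n))).
  by rewrite -addrA -mulrDl addrA subrK.
exists (v 0 + u 0 / e) => _ [n _ <-].
apply: (@le_trans _ _ (series v n.+1)); first by rewrite seriesSr lerDl.
apply: (le_trans (bd n)); rewrite lerD2l ler_pM2r ?invr_gt0// gerBl.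
exact: expR_ge0.
Qed.

Lemma expR_le_fact (M : nat) (x : R) : 0 < x -> expR (- x) <= M.+1`!%:R / x ^+ M.+1.
Proof.
move=> x0; rewrite expRN -invf_div lef_pV2 ?posrE ?expR_gt0 ?divr_gt0 ?exprn_gt0 ?ltr0n ?fact_gt0//.
by have := @expR_ge1Dxn R x M (ltW x0); lra.
Qed.

Lemma measure_bigsetU_le d (T : measurableType d) (P : {measure set T -> \bar R})
  (I : Type) (q : seq I) (F : I -> set T) (x : R) : 0 <= x ->
  (forall i, measurable (F i)) -> (forall i, (P (F i) <= x%:E)%E) ->
  (P (\big[setU/set0]_(i <- q) F i) <= ((size q)%:R * x)%:E)%E.
Proof.
move=> x0 mF Fx; elim: q => [|i q IH]; first by rewrite big_nil measure0 lee_fin mul0r.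
rewrite big_cons; apply: (@le_trans _ _ (P (F i) + P (\big[setU/set0]_(i <- q) F i))%E).
  by apply: measureU2 => //; apply: bigsetU_measurable.
by rewrite /= -natr1 mulrDl mul1r addrC EFinD; apply: leeD.
Qed.
End summability.

(** Since [kappa <= rho], each factor is at least a constant times [exp (- rho * w k ^ 2 / 2)], and
    these multiply to at least [exp (- rho * be * L)]. The constants come from the square root,
    bounded by [1 + bs ^ 2], and from replacing [a k * w k] by the nearby [v k]. *)
Lemma exp_gmean_le (R : realType) (p n : nat) (a w v : 'I_p -> R) (bs be L : R) :
  n%:R = expR L -> (forall k, 0 <= a k <= bs) ->
  \sum_k w k ^+ 2 <= 2 * be * L -> (forall k, `|v k ^+ 2 - (a k * w k) ^+ 2| <= 1) ->
  expR ((1 - bs ^+ 2 / (1 + bs ^+ 2) * be) * L - p%:R * (ln (1 + bs ^+ 2) + 2^-1)) <= gmean n a v.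
Proof.
move=> nE ab wL vw; set rho := bs ^+ 2 / _; set l := ln _.
have bs2 := sqr_ge0 bs.
have rho0 : 0 <= rho by rewrite divr_ge0 ?addr_ge0.
rewrite /gmean nE.
apply: (@le_trans _ _ (expR L * \prod_(k < p) expR (- (rho * w k ^+ 2 / 2) - (l + 2^-1)))).
  rewrite -expR_sum -expRD ler_expR sumrB sumr_const card_ord -mulr_natl sumrN.
  rewrite -mulr_suml -mulr_sumr.
  have : rho * (\sum_k w k ^+ 2) <= rho * (2 * be * L) by rewrite ler_wpM2l.
  lra.
rewrite ler_wpM2l ?expR_ge0//; apply: ler_prod => k _; rewrite expR_ge0/=.
have [a0 abk] := andP (ab k).
have a2 := sqr_ge0 (a k).
have rk : a k ^+ 2 / (1 + a k ^+ 2) <= rho.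
  by apply: (@kappa_mono _ _ _ (fun=> bs) k k); rewrite a0.
have a2b : a k ^+ 2 <= bs ^+ 2 by rewrite lerXn2r ?nnegrE//; exact: le_trans abk.
have q0 : 0 < 1 + a k ^+ 2 by rewrite ltr_pwDl.
have qi : (1 + a k ^+ 2)^-1 <= 1 by rewrite invf_le1// lerDl.
have qi0 : 0 <= (1 + a k ^+ 2)^-1 by rewrite invr_ge0 ltW.
rewrite opprD addrCA expRD; apply: ler_pM; rewrite ?expR_ge0//.
  rewrite expRN lnK ?posrE; last by rewrite ltr_pwDl.
  rewrite lef_pV2 ?posrE ?sqrtr_gt0//; last by rewrite ltr_pwDl.
  apply: (@le_trans _ _ (1 + a k ^+ 2)); last by rewrite lerD2l.
  rewrite -[leRHS](sqr_sqrtr (ltW q0)) expr2 ler_peMl ?sqrtr_ge0//.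
  by rewrite -[leLHS]sqrtr1 ler_wsqrtr// lerDl.
rewrite ler_expR mulNr -opprD lerN2 invfM.
have := ler_normlW (vw k); rewrite lerBlDr => vk.
have h1 : v k ^+ 2 * (1 + a k ^+ 2)^-1 <= (1 + (a k * w k) ^+ 2) * (1 + a k ^+ 2)^-1 by rewrite ler_wpM2r.
have h2 : a k ^+ 2 / (1 + a k ^+ 2) * w k ^+ 2 <= rho * w k ^+ 2 by rewrite ler_wpM2r ?sqr_ge0.
rewrite exprMn in h1; lra.
Qed.

Lemma grid_approx (R : realType) (n : nat) (y : R) : (0 < n)%N -> `|y| <= n%:R ->
  exists m : 'I_(2 * n ^ 2).+1, `|m%:R / n%:R - n%:R - y| <= n%:R^-1.
Proof.
move=> n0 /ler_normlP[y1 y2]; have n1 : 0 < n%:R :> R by rewrite ltr0n.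
pose x := (y + n%:R) * n%:R.
have x0 : 0 <= x by rewrite mulr_ge0//; lra.
have [/andP[m1 m2]] := truncn_itv x0.
have xle : x <= (2 * n ^ 2)%:R.
  by rewrite natrM natrX expr2 mulrA ler_pM2r//; lra.
have mb : (Num.truncn x < (2 * n ^ 2).+1)%N.
  by rewrite ltnS -(ler_nat R) (le_trans m1).
exists (Ordinal mb) => /=.
have -> : (Num.truncn x)%:R / n%:R - n%:R - y = ((Num.truncn x)%:R - x) / n%:R.
  by rewrite /x; field; rewrite gt_eqF.
rewrite normrM [`|n%:R^-1|]ger0_norm ?invr_ge0// ler_piMl ?invr_ge0//.
rewrite distrC ger0_norm ?subr_ge0//; move: m2; rewrite -natr1; lra.
Qed.

(** * Norm bounds and accurate kernel sums for all large n, almost surely *)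

Section almost_sure.
Context d (Omega : measurableType d) (R : realType) (P : probability Omega R).
Variables (p : nat) (X : nat -> Omega -> 'rV[R]_p).
Hypothesis rX : forall i, random_vector (X i).
Hypothesis iX : mutually_independent P X.
Variable W : nat -> Omega -> 'I_p -> R.
Hypothesis sW : forall i k, sigma_meas X i (fun w => W i w k).
Hypothesis gW : forall i (a : 'I_p -> R), 0 < \sum_k a k ^+ 2 ->
  forall B : set R, measurable B ->
  P [set w | B (\sum_k a k * W i w k)] = normal_prob 0 (Num.sqrt (\sum_k a k ^+ 2)) B.

Let mW i k : measurable_fun setT (fun w => W i w k).
Proof. exact: (sigma_meas_measurable rX (@sW i k)). Qed.

Let msq i : measurable_fun setT (fun w => \sum_k W i w k ^+ 2).
Proof. by apply: measurable_sum => k; exact: measurable_funX. Qed.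

Lemma gaussian_norm_tail (c x : R) i : 0 < c < 1 ->
  (P [set w | (x < \sum_k W i w k ^+ 2)%R] <=
   ((Num.sqrt (1 - c))^-1 ^+ p * expR (- (c * x / 2)))%:E)%E.
Proof.
move=> /andP[c0 c1]; set A := [set w | _].
have mA : measurable A.
  rewrite /A (_ : [set w | _] = (fun w => \sum_k W i w k ^+ 2) @^-1` `]x, +oo[%classic).
    by rewrite -[X in measurable X]setTI; exact: msq.
  by apply/seteqP; split => w /=; rewrite in_itv/= andbT.
have mE : measurable_fun setT (fun w => expR (c * (\sum_k W i w k ^+ 2) / 2)).
  by apply: measurableT_comp => //; apply: measurable_funM => //; exact: measurable_funM.
apply: (@le_trans _ _ (\int[P]_w ((expR (- (c * x / 2)))%:E *
    (expR (c * (\sum_k W i w k ^+ 2) / 2))%:E))%E).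
  rewrite -[X in P X]setIT -integral_indic//.
  apply: ge0_le_integral => //.
  - by apply/measurable_EFinP.
  - by apply: emeasurable_funM => //; apply/measurable_EFinP.
  - move=> w _; rewrite -EFinM lee_fin indicE; case: (boolP (w \in A)) => [/set_mem Aw|_]; last first.
      by rewrite mulr_ge0 ?expR_ge0.
    rewrite -expRD -[leLHS]expR0 ler_expR.
    have : c * x <= c * (\sum_k W i w k ^+ 2) by rewrite ler_pM2l// ltW.
    lra.
rewrite ge0_integralZl_EFin ?expR_ge0//; last exact/measurable_EFinP.
have c01 : 0 <= c < 1 by rewrite ltW.
have := @gaussian_square_mgf _ _ _ P p (W i) (mW i) (gW i) c (index_enum 'I_p) (fun=> 0) c01
  (index_enum_uniq _) (fun k _ => erefl).
rewrite [in RHS]big1 ?mul0r ?expR0 ?mulr1; last by move=> k _; rewrite expr0n.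
move=> h; rewrite mulrC EFinM muleC.
have sz : size (index_enum 'I_p) = p by rewrite -[RHS](card_ord p) cardT enumT.
rewrite sz in h; rewrite -h; apply: lee_wpmul2r; first by rewrite lee_fin expR_ge0.
rewrite le_eqVlt; apply/orP; left; apply/eqP.
apply: eq_integral => w _; congr EFin.
rewrite [\sum_k 0 * _]big1 ?expR0 ?mulr1; last by move=> k _; rewrite mul0r.
by rewrite -expR_sum mulr_sumr mulr_suml.
Qed.

Lemma gaussian_norm_ae (be : R) : 1 < be ->
  {ae P, forall w, \forall i \near \oo, \sum_k W i w k ^+ 2 <= 2 * be * ln (i.+1%:R : R)}.
Proof.
(* Midway between [1 / be] and [1]: [c < 1] keeps the exponential moment finite, and [c * be > 1]
   makes the tails summable. *)
move=> be1; pose c : R := (1 + be^-1) / 2.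
have be0 : 0 < be by lra.
have bi : be^-1 < 1 by rewrite invf_lt1.
have bi0 : 0 < be^-1 by rewrite invr_gt0.
have c01 : 0 < c < 1 by rewrite /c; lra.
have cb : c * be = 1 + (be - 1) / 2 by rewrite /c; field; rewrite gt_eqF.
pose K : R := (Num.sqrt (1 - c))^-1 ^+ p.
pose B i := [set w | (2 * be * ln (i.+1%:R : R) < \sum_k W i w k ^+ 2)%R].
have mB i : measurable (B i).
  rewrite /B (_ : [set w | _] = (fun w => \sum_k W i w k ^+ 2) @^-1` `]2 * be * ln (i.+1%:R : R), +oo[%classic).
    by rewrite -[X in measurable X]setTI; exact: msq.
  by apply/seteqP; split => w /=; rewrite in_itv/= andbT.
have PB i : (P (B i) <= (K * expR (- ((1 + (be - 1) / 2) * ln (i.+1%:R : R))))%:E)%E.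
  apply: (le_trans (gaussian_norm_tail _ _ c01)); rewrite lee_fin /K -cb.
  rewrite le_eqVlt; apply/orP; left; apply/eqP; congr (_ * expR _); by field.
have cS : cvgn (series (fun i => K * expR (- ((1 + (be - 1) / 2) * ln (i.+1%:R : R))))).
  have e0 : 0 < (be - 1) / 2 by lra.
  rewrite (_ : series _ = K *: series (fun n => expR (- ((1 + (be - 1) / 2) * ln (n.+1%:R : R))))); last first.
    by apply/funext => n; rewrite /series/= -mulr_sumr.
  by apply: is_cvgMr; exact: cvg_series_npow.
have := borel_cantelli_ae mB PB cS.
apply: filterS => w; apply: filterS => i; rewrite /B /= => /negP.
by rewrite -leNgt.
Qed.

Variables (s : 'I_p -> R) (bs b : R).
Hypotheses (bs1 : 1 <= bs) (sb : forall k, 0 <= s k <= bs) (b01 : 0 < b <= 1).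

Definition rn (n : nat) : R := Num.sqrt (Num.sqrt (ln n%:R)).

Lemma rn_pow4 n : (0 < n)%N -> n%:R = expR (rn n ^+ 4).
Proof.
move=> n0; have n1 : 1 <= n%:R :> R by rewrite ler1n.
rewrite (_ : 4 = 2 * 2)%N// exprM !sqr_sqrtr ?ln_ge0 ?sqrtr_ge0//.
by rewrite lnK// posrE; lra.
Qed.

Lemma near_rn_ge (K : R) : \forall n \near \oo, K <= rn n.
Proof.
near=> n.
have n0 : (0 < n)%N by near: n; exact: nbhs_infty_gt.
have hn : expR (`|K| ^+ 4) <= n%:R by near: n; exact: nbhs_infty_ger.
move: hn; rewrite (rn_pow4 n0) ler_expR ler_pXn2r ?nnegrE ?sqrtr_ge0//.
by move=> h; apply: le_trans (ler_norm K) _.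
Unshelve. all: by end_near. Qed.

Definition hn n : R := expR (- (b * rn n ^+ 4)).
Definition deln n : R := expR (- (2 * b * rn n ^+ 4)).

(** Mesh [1 / n] on the cube of half-side [n]: polynomially many points in [n], in a box that
    eventually holds all the samples. *)
Definition gridpt n (m : {ffun 'I_p -> 'I_(2 * n ^ 2).+1}) (k : 'I_p) : R :=
  (m k)%:R / n%:R - n%:R.
Definition testpt n (q : {ffun 'I_p -> 'I_(2 * n ^ 2).+1} * 'I_p * 'I_3) : 'I_p -> R :=
  shift (gridpt q.1.1) q.1.2 (nth 0 [:: 0; hn n; - hn n] q.2).

Definition deviates n t (v : 'I_p -> R) : set Omega :=
  [set w | ~~ (`|gsum n (fun j k => alpha s t k * W j w k) v - gmean n (alpha s t) v|
     <= deln n * gmean n (alpha s t) v)].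

(* Points where the mean is small are not tested: there the relative
   Chernoff bound would be void. *)
Definition bad n : set Omega :=
  \big[setU/set0]_(t <- iota 0 n)
    \big[setU/set0]_(q <- enum {: {ffun 'I_p -> 'I_(2 * n ^ 2).+1} * 'I_p * 'I_3})
      (if expR (8 * b * rn n ^+ 4) <= gmean n (alpha s t) (testpt q)
       then deviates n t (testpt q) else set0).

Let sgk (a v : 'I_p -> R) i : sigma_meas X i (fun w => gk (fun k => v k - a k * W i w k)).
Proof.
rewrite /sigma_meas /gk; apply: measurableT_comp => //.
apply: measurable_funM => //; apply: measurableT_comp => //.
apply: measurable_sum => k; apply: measurable_funX; apply: measurable_funB => //.
by apply: measurable_funM => //; exact: sW.
Qed.

Lemma deviates_measurable n t v : measurable (deviates n t v).
Proof.
rewrite /deviates.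
rewrite (_ : [set w | _] = (fun w => `|gsum n (fun j k => alpha s t k * W j w k) v - gmean n (alpha s t) v|)
   @^-1` `]deln n * gmean n (alpha s t) v, +oo[%classic).
  rewrite -[X in measurable X]setTI.
  have ml : measurable_fun setT (fun w => `|gsum n (fun j k => alpha s t k * W j w k) v - gmean n (alpha s t) v|).
    apply: measurableT_comp => //; apply: measurable_funB => //.
    by apply: measurable_sum => j; exact: (sigma_meas_measurable rX (@sgk _ _ j)).
  exact: ml.
by apply/seteqP; split => w /=; rewrite in_itv/= andbT ltNge.
Qed.

(** The threshold [n ^ (8 b)] on the mean, times [deln n ^ 2 = n ^ (- 4 b)], leaves [n ^ (4 b)] in
    the Chernoff exponent. *)
Lemma deviates_prob n t v :
  expR (8 * b * rn n ^+ 4) <= gmean n (alpha s t) v ->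
  (P (deviates n t v) <= (2 * expR (- (expR (4 * b * rn n ^+ 4) / 4)))%:E)%E.
Proof.
move=> big.
pose z i w := gk (fun k => v k - alpha s t k * W i w k).
pose c := \prod_k ((Num.sqrt (1 + alpha s t k ^+ 2))^-1 *
   expR (- (v k ^+ 2) / (2 * (1 + alpha s t k ^+ 2)))).
have zc i : (\int[P]_w (z i w)%:E = c%:E)%E.
  (* Zero frequency and zero phase: the cosine is [1] and the product of kernels remains. *)
  have := @gaussian_kernel_charfun _ _ _ P p (W i) (mW i) (gW i) (alpha s t) v
    (index_enum 'I_p) (fun=> 0) 0 (index_enum_uniq _) (fun k _ => erefl).
  rewrite [X in - X / 2]big1; last by move=> k _; rewrite expr0n.
  rewrite oppr0 mul0r expR0 cos0 !mulr1 => <-.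
  apply: eq_integral => w _; congr EFin.
  rewrite (_ : \sum_k 0 * W i w k = 0); last by rewrite big1// => k _; rewrite mul0r.
  rewrite addr0 cos0 mulr1 -expR_sum /z /gk; congr expR.
  by rewrite -sumrN mulr_suml; apply: eq_bigr => k _; field.
have z01 i w : 0 <= z i w <= 1 by rewrite gk_le1 andbT ltW// gk_gt0.
have d01 : 0 < deln n <= 1.
  rewrite expR_gt0/= -expR0 ler_expR oppr_le0; case/andP: b01 => b0 _.
  by rewrite !mulr_ge0 ?exprn_ge0 ?sqrtr_ge0// ltW.
have := @chernoff01 _ _ _ P p X rX iX z c (fun i => @sgk _ _ i) z01 zc n (deln n) d01.
move=> /le_trans; apply; rewrite lee_fin ler_pM2l// ler_expR lerN2 ler_pM2r//.
rewrite -/(gmean n (alpha s t) v).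
apply: (@le_trans _ _ (expR (8 * b * rn n ^+ 4) * deln n ^+ 2)); last first.
  by rewrite ler_wpM2r ?sqr_ge0.
rewrite /deln -expRM_natr -expRD ler_expR le_eqVlt; apply/orP; left; apply/eqP; ring.
Qed.

Lemma bad_measurable n : measurable (bad n).
Proof.
apply: bigsetU_measurable => t _; apply: bigsetU_measurable => q _.
by case: ifPn => // _; exact: deviates_measurable.
Qed.

Lemma bad_ae : {ae P, forall w, \forall n \near \oo, ~ bad n w}.
Proof.
have [b0 b1] := andP b01.
(* The number of tests is at most a constant times [n ^ (2 p + 1)]. As [4 * b * M.+1 > 2 p + 3], the
   failure bound is of order [n ^ (- 2 p - 3)], which leaves a summable [n ^ (- 2)]. *)
pose M := Num.truncn ((2 * p%:R + 3) / (4 * b)).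
pose K : R := 6 * p%:R * 3 ^+ p * (M.+1`!%:R * 4 ^+ M.+1).
have K0 : 0 <= K by rewrite /K; do 3?[apply: mulr_ge0 => //]; exact: exprn_ge0.
have pow n : (0 < n)%N -> 
  n%:R * (#|{: {ffun 'I_p -> 'I_(2 * n ^ 2).+1} * 'I_p * 'I_3}|%:R *
    (2 * expR (- (expR (4 * b * rn n ^+ 4) / 4)))) <= 4 * K * expR (- ((1 + 1) * ln (n.+1%:R : R))).
  move=> n0; rewrite !card_prod card_ffun !card_ord.
  set L := rn n ^+ 4.
  have L0 : 0 <= L by rewrite exprn_ge0// sqrtr_ge0.
  have nE : n%:R = expR L := rn_pow4 n0.
  have n1 : 1 <= n%:R :> R by rewrite ler1n.
  have c1 : ((2 * n ^ 2).+1%:R : R) <= 3 * expR (2 * L).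
    have -> : expR (2 * L) = n%:R ^+ 2 by rewrite nE -expRM_natr mulrC.
    rewrite -natr1 natrM natrX; have : 1 <= n%:R ^+ 2 :> R by rewrite exprn_ege1.
    lra.
  have c2 : (((2 * n ^ 2).+1 ^ p)%:R : R) <= 3 ^+ p * expR (2 * p%:R * L).
    rewrite natrX (_ : 2 * p%:R * L = 2 * L * p%:R); last by ring.
    by rewrite expRM_natr -exprMn lerXn2r ?nnegrE ?mulr_ge0 ?expR_ge0.
  have c3 : expR (- (expR (4 * b * L) / 4)) <= (M.+1`!%:R * 4 ^+ M.+1) * expR (- ((2 * p%:R + 3) * L)).
    apply: (le_trans (expR_le_fact M _)); first by rewrite divr_gt0 ?expR_gt0.
    rewrite expr_div_n invf_div mulrA -expRM_natr -expRN ler_wpM2l ?mulr_ge0 ?exprn_ge0//.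
    rewrite ler_expR lerN2.
    have : (2 * p%:R + 3) / (4 * b) < M.+1%:R by apply: truncnS_gt.
    rewrite ltr_pdivrMr; last lra.
    move=> /ltW h; have : (2 * p%:R + 3) * L <= M.+1%:R * (4 * b) * L by rewrite ler_wpM2r.
    lra.
  have c4 : expR (- (2 * L)) <= 4 * expR (- ((1 + 1) * ln (n.+1%:R : R))).
    rewrite !expRN (_ : 2 * L = L * 2%:R) ?expRM_natr -?nE; last by ring.
    rewrite (_ : (1 + 1) * ln n.+1%:R = ln n.+1%:R * 2%:R) ?expRM_natr ?lnK ?posrE//; last by ring.
    rewrite ler_pdivlMr ?exprn_gt0// mulrC ler_pdivrMr ?exprn_gt0//; last lra.
    rewrite (_ : 4 * n%:R ^+ 2 = (2 * n%:R) ^+ 2); last by ring.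
    by rewrite lerXn2r ?nnegrE ?mulr_ge0// -natr1; lra.
  apply: (@le_trans _ _ (K * expR (- (2 * L)))); last first.
    rewrite (_ : 4 * K * _ = K * (4 * expR (- ((1 + 1) * ln n.+1%:R)))); last by ring.
    by rewrite ler_wpM2l.
  rewrite natrM natrM nE.
  set a := _%:R in c2 *; set E := expR (- (_ / 4)) in c3 *.
  set e1 := expR _ in c2; set F := (_ * 4 ^+ M.+1) in c3 *; set e2 := expR _ in c3.
  have eq : expR (- (2 * L)) = expR L * (e1 * e2).
    by rewrite /e1 /e2 -!expRD; congr expR; ring.
  have -> : expR L * (a * p%:R * 3 * (2 * E)) = (6 * p%:R * expR L) * (a * E) by ring.
  have -> : K * expR (- (2 * L)) = (6 * p%:R * expR L) * ((3 ^+ p * e1) * (F * e2)).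
    by rewrite eq /K /F; ring.
  rewrite ler_wpM2l ?mulr_ge0 ?expR_ge0//.
  by apply: ler_pM => //; exact: expR_ge0.
have PB n : (P (bad n) <= (4 * K * expR (- ((1 + 1) * ln (n.+1%:R : R))))%:E)%E.
  case: n => [|n].
    by rewrite /bad/= big_nil measure0 lee_fin mulr_ge0 ?expR_ge0// mulr_ge0.
  have := pow n.+1 isT; rewrite -lee_fin; apply: le_trans.
  rewrite -[X in X%:R * _](size_iota 0) cardE.
  have x0 : 0 <= 2 * expR (- (expR (4 * b * rn n.+1 ^+ 4) / 4)) by rewrite mulr_ge0// expR_ge0.
  apply: measure_bigsetU_le.
  - by rewrite mulr_ge0.
  - move=> t; apply: bigsetU_measurable => q _.
    by case: ifPn => // _; exact: deviates_measurable.
  - move=> t; apply: measure_bigsetU_le => //.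
    + by move=> q; case: ifPn => // _; exact: deviates_measurable.
    + move=> q; case: ifPn => [h|_]; first exact: deviates_prob.
      by rewrite measure0 lee_fin.
apply: (borel_cantelli_ae bad_measurable PB).
rewrite (_ : series _ = (4 * K) *: series (fun n => expR (- ((1 + 1) * ln (n.+1%:R : R))))); last first.
  by apply/funext => n; rewrite /series/= -mulr_sumr.
by apply: is_cvgMr; exact: cvg_series_npow.
Qed.

(** Take for [g] a grid point within [1 / n] of the ideal position. The norm bound puts the means at
    its shifts above the threshold in [bad], so a failed test there would place [w] in [bad n]. *)
Lemma not_bad_good (w : Omega) (n : nat) (be D : R) : (1 < n)%N ->
  let r := rn n in
  16 * b = 1 - bs ^+ 2 / (1 + bs ^+ 2) * be ->
  p%:R * (ln (1 + bs ^+ 2) + 2^-1) <= 8 * b * r ^+ 4 ->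
  (forall j, (j < n)%N -> \sum_k W j w k ^+ 2 <= 2 * be * r ^+ 4) ->
  ~ bad n w -> (forall j k, (j < n)%N -> `|s k * W j w k| <= D) ->
  hn n * (D + 1) <= 4^-1 -> n%:R^-1 <= hn n ->
  forall t i, (t < n)%N -> (i < n)%N -> exists g : 'I_p -> R,
    (forall k, `|g k - alpha s t k * W i w k| <= n%:R^-1) /\
    (forall k (e : R), e \in [:: 0; hn n; - hn n] ->
      `|gsum n (fun j k => alpha s t k * W j w k) (shift g k e) -
        gmean n (alpha s t) (shift g k e)| <= deln n * gmean n (alpha s t) (shift g k e)).
Proof.
move=> n1 r bE rL wL nbad wD hD hn1 t i tn iN.
have n0 : (0 < n)%N by exact: ltn_trans n1.
have n0R : 0 < n%:R :> R by rewrite ltr0n.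
have s0 k : 0 <= s k by case/andP: (sb k).
have h0 : 0 < hn n := expR_gt0 _.
have a0 k := alpha_ge0 t k s0.
have aw k : `|alpha s t k * W i w k| <= D.
  apply: le_trans (wD i k iN); rewrite !normrM ler_wpM2r//.
  by rewrite !ger0_norm// alpha_decr.
have Dn k : `|alpha s t k * W i w k| <= n%:R.
  have D0 := le_trans (normr_ge0 _) (aw k).
  apply: (le_trans (aw k)).
  (* The two inequalities on [hn n] give [D + 1 <= n / 4], so the point lies in the box of the
     grid. *)
  have : n%:R^-1 * (D + 1) <= 4^-1 by apply: le_trans hD; rewrite ler_wpM2r// addr_ge0.
  rewrite mulrC ler_pdivrMr//; lra.
have [m mP] := choice (fun k => grid_approx n0 (Dn k)).
exists (gridpt [ffun k => m k]); split=> [k|k e eh].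
  by rewrite /gridpt ffunE.
pose ie : 'I_3 := inord (index e [:: 0; hn n; - hn n]).
have ieE : nth 0 [:: 0; hn n; - hn n] ie = e.
  rewrite /ie inordK ?nth_index//.
  by have := index_mem e [:: 0; hn n; - hn n]; rewrite eh.
pose q := ([ffun k => m k] : {ffun 'I_p -> 'I_(2 * n ^ 2).+1}, k, ie).
have qE : testpt q = shift (gridpt [ffun k => m k]) k e by rewrite /testpt/= ieE.
rewrite -qE; apply/negPn/negP => dev; apply: nbad.
(* Half of the exponent [16 * b] pays for the constant in [exp_gmean_le]; the squares differ by at
   most [4 * hn n * (D + hn n) <= 1]. *)
have big : expR (8 * b * r ^+ 4) <= gmean n (alpha s t) (testpt q).
  apply: (le_trans _ (@exp_gmean_le _ p n (alpha s t) (W i w) (testpt q) bs be (r ^+ 4) (rn_pow4 n0) _ (wL i iN) _)).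
  - by rewrite ler_expR -bE; lra.
  - by move=> l; rewrite a0/= (le_trans (alpha_decr _ _ s0))//; case/andP: (sb l).
  - move=> l; set y := alpha s t l * W i w l.
    rewrite subr_sqr normrM.
    have h1 : hn n <= 1.
      rewrite -expR0 ler_expR oppr_le0 mulr_ge0 ?exprn_ge0 ?sqrtr_ge0//.
      by case/andP: b01 => /ltW.
    have eh' : `|e| <= hn n.
      by move: eh; rewrite !inE => /or3P[]/eqP ->; rewrite ?normr0 ?normrN ?(ger0_norm (ltW h0)) // ltW.
    have vy : `|testpt q l - y| <= 2 * hn n.
      rewrite qE /shift /gridpt ffunE addrAC; apply: (le_trans (ler_normD _ _)).
      have := mP l; rewrite -/y; case: (l == k); rewrite ?normr0; lra.
    have vy2 : `|testpt q l + y| <= 2 * D + 2 * hn n.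
      rewrite (_ : testpt q l + y = (testpt q l - y) + 2 * y); last by ring.
      apply: (le_trans (ler_normD _ _)); rewrite normrM ger0_norm// addrC.
      by apply: lerD => //; rewrite ler_pM2l//; exact: aw.
    apply: (@le_trans _ _ (2 * hn n * (2 * D + 2 * hn n))); first by apply: ler_pM.
    have : hn n * hn n <= hn n * 1 by rewrite ler_pM2l.
    lra.
rewrite /bad -bigcup_seq; exists t; first by rewrite /= mem_iota.
rewrite -bigcup_seq; exists q; first by rewrite /= mem_enum.
by rewrite big; exact: dev.
Qed.
End almost_sure.

Lemma msiter_gaussian_ae (R : realType) d (Omega : measurableType d) (P : probability Omega R)
  (p : nat) (X : nat -> Omega -> 'rV[R]_p) (W : nat -> Omega -> 'I_p -> R) (s : 'I_p -> R) (bs : R) :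
  (forall i, random_vector (X i)) -> mutually_independent P X ->
  (forall i k, sigma_meas X i (fun w => W i w k)) ->
  (forall i (a : 'I_p -> R), 0 < \sum_k a k ^+ 2 ->
    forall B : set R, measurable B ->
    P [set w | B (\sum_k a k * W i w k)] = normal_prob 0 (Num.sqrt (\sum_k a k ^+ 2)) B) ->
  1 <= bs -> (forall k, 0 <= s k <= bs) ->
  {ae P, forall w, exists c : nat -> 'I_p -> R,
    (forall n i k, (i < n)%N ->
      msiter n (fun j k => s k * W j w k) t i k @[t --> \oo] --> c n k) /\
    (forall k, c n k @[n --> \oo] --> (0 : R))}.
Proof.
move=> rX iX sW gW bs1 sb.
pose rho := bs ^+ 2 / (1 + bs ^+ 2).
have bs2 : 1 <= bs ^+ 2 by rewrite exprn_ege1.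
have [rho0 rho1] : 0 < rho /\ rho < 1.
  by split; rewrite /rho; [apply: divr_gt0; lra|rewrite ltr_pdivrMr; lra].
(* Strictly between [1] and [1 / rho]: the norm bound needs the former, a positive exponent
   [1 - rho * be] the latter. *)
pose be := 2 / (1 + rho).
have be1 : 1 < be by rewrite /be ltr_pdivlMr; lra.
have be2 : be <= 2 by rewrite /be ler_pdivrMr; lra.
have rb : rho * be < 1 by rewrite /be mulrA ltr_pdivrMr; lra.
have rb0 : 0 < rho * be by rewrite mulr_gt0//; lra.
pose b := (1 - rho * be) / 16.
have b01 : 0 < b <= 1 by rewrite /b; apply/andP; split; lra.
have bE : 16 * b = 1 - bs ^+ 2 / (1 + bs ^+ 2) * be by rewrite /b -/rho; lra.
(* As [2 * be >= 1], it may replace its own square root in the bound on the coordinates. *)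
pose c := bs * (2 * be).
have c1 : 1 <= c by rewrite /c -[leLHS]mulr1; apply: ler_pM => //; lra.
have [C [r0 [C0 r02 small]]] := msiter_small bs1 sb c1 b01.
have N := gaussian_norm_ae rX sW gW be1.
have B := bad_ae rX iX sW gW s b01.
apply: filterS2 N B => w [N _ NP] Bw.
pose y (j : nat) (k : 'I_p) := s k * W j w k.
have [L LP] : exists L : nat -> 'I_p -> R, forall n, (0 < n)%N ->
    (forall i k, (i < n)%N -> msiter n y t i k @[t --> \oo] --> L n k) /\
    (forall t (B : R), (forall j k, (j < n)%N -> `|msiter n y t j k| <= B) ->
      forall k, `|L n k| <= B).
  have /choice[L LP] : forall n, exists l : 'I_p -> R, (0 < n)%N ->
    (forall i k, (i < n)%N -> msiter n y t i k @[t --> \oo] --> l k) /\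
    (forall t (B : R), (forall j k, (j < n)%N -> `|msiter n y t j k| <= B) ->
      forall k, `|l k| <= B).
    case=> [|n]; first by exists (fun=> 0).
    by have [l lP] := @msiter_cvg _ p n.+1 y isT; exists l.
  by exists L.
exists L; split=> [n i k iN|k]; first by have [h _] := LP n (leq_ltn_trans (leq0n i) iN); exact: h.
have small_near : \forall n \near \oo, forall k, `|L n k| <= C / rn R n.
  (* [M] bounds the finitely many samples before index [N], where the almost sure norm bound may
     fail; [rn R n ^ 4] overtakes it. *)
  pose M := \sum_(j < N) \sum_k W j w k ^+ 2.
  have M0 : 0 <= M by rewrite sumr_ge0// => j _; rewrite sumr_ge0// => k' _; exact: sqr_ge0.
  pose K := p%:R * (ln (1 + bs ^+ 2) + 2^-1) / (8 * b).
  near=> n; move=> k'.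
  have n1 : (1 < n)%N by near: n; exact: nbhs_infty_gt.
  have n0 : (0 < n)%N by exact: ltn_trans n1.
  have r1 : 1 <= rn R n by near: n; exact: near_rn_ge.
  have rr0 : r0 <= rn R n by near: n; exact: near_rn_ge.
  have rK : K <= rn R n by near: n; exact: near_rn_ge.
  have rM : M <= rn R n by near: n; exact: near_rn_ge.
  have nb : ~ bad W s b n w by near: n.
  have r4 : rn R n <= rn R n ^+ 4.
    by rewrite -[leLHS]expr1 ler_weXn2l.
  have wL j : (j < n)%N -> \sum_k W j w k ^+ 2 <= 2 * be * rn R n ^+ 4.
    move=> jn; have [jN|Nj] := ltnP j N.
      apply: (@le_trans _ _ M).
        rewrite /M (bigD1 (Ordinal jN))//= lerDl sumr_ge0// => i _.
        by rewrite sumr_ge0// => l _; exact: sqr_ge0.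
      have : 1 * rn R n ^+ 4 <= 2 * be * rn R n ^+ 4 by rewrite ler_wpM2r//; lra.
      lra.
    apply: (le_trans (NP j Nj)); rewrite ler_wpM2l//; first lra.
    have jn' : j.+1%:R <= expR (rn R n ^+ 4) :> R by rewrite -rn_pow4// ler_nat.
    by rewrite -[leRHS]expRK ler_ln ?posrE ?expR_gt0.
  have wD j l : (j < n)%N -> `|s l * W j w l| <= c * rn R n ^+ 2.
    move=> jn; rewrite normrM /c -mulrA; apply: ler_pM => //.
      by rewrite ger0_norm; case/andP: (sb l).
    have r20 : 0 <= rn R n ^+ 2 by exact: sqr_ge0.
    have be0 : 0 <= 2 * be by lra.
    rewrite -(@ler_pXn2r _ 2) ?nnegrE ?(mulr_ge0 be0 r20)//.
    rewrite real_normK ?num_real//; apply: (@le_trans _ _ (2 * be * rn R n ^+ 4)).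
      apply: le_trans (wL j jn); rewrite (bigD1 l)//= lerDl sumr_ge0// => i _.
      exact: sqr_ge0.
    rewrite exprMn -exprM expr2 ler_wpM2r ?exprn_ge0//; first lra.
    by rewrite -[leLHS]mulr1 ler_wpM2l; lra.
  have rL : p%:R * (ln (1 + bs ^+ 2) + 2^-1) <= 8 * b * rn R n ^+ 4.
    have b8 : 0 < 8 * b by case/andP: b01 => ? _; rewrite mulr_gt0.
    by rewrite [leRHS]mulrC -ler_pdivrMr//; exact: le_trans rK r4.
  have [T TP] := small n (rn R n) (W ^~ w) rr0 (rn_pow4 R n0) wD
    (not_bad_good sb b01 n1 bE rL wL nb wD).
  by have [_ /(_ T _ TP)] := LP n n0.
apply/cvgr0Pnorm_le => e e0; near=> n.
have h : forall k, `|L n k| <= C / rn R n by near: n.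
have r1 : 1 <= rn R n by near: n; exact: near_rn_ge.
have re : C / e <= rn R n by near: n; exact: near_rn_ge.
apply: (le_trans (h k)); rewrite ler_pdivrMr; last lra.
by rewrite mulrC -ler_pdivrMr.
Unshelve. all: by end_near. Qed.

(** * Rotation to independent coordinates *)

Lemma cvg_rV (R : realType) (p : nat) (f : nat -> 'rV[R]_p) (c : 'rV[R]_p) :
  (forall k, f t 0 k @[t --> \oo] --> c 0 k) -> f t @[t --> \oo] --> c.
Proof.
move=> fc; apply/cvg_ballP => e e0.
have h : \forall t \near \oo, forall k, ball (c 0 k) e (f t 0 k).
  by apply: filter_forall => k; have /cvg_ballP := fc k; apply.
near=> t; split => // i k; rewrite ord1.
by move: k; near: t.
Unshelve. all: by end_near. Qed.

Lemma cvg_rV_mulmx (R : realType) (p q : nat) (f : nat -> 'rV[R]_p) (c : 'rV[R]_p) (U : 'M[R]_(p, q)) :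
  (forall k, f t 0 k @[t --> \oo] --> c 0 k) -> (f t *m U) @[t --> \oo] --> c *m U.
Proof.
move=> fc; apply: cvg_rV => l; rewrite mxE.
rewrite (_ : (fun t => _) = fun t => \sum_k f t 0 k * U k l); last first.
  by apply/funext => t; rewrite mxE.
by apply: cvg_big => [|k _]; [exact: add_continuous|exact: cvgM (fc k) (cvg_cst _)].
Qed.

Lemma gkernel_rotate (R : realType) (p : nat) (tau : R) (U : 'M[R]_p) (u : 'rV_p) (v : 'I_p -> R) :
  0 < tau -> U^T *m U = 1%:M -> (forall k, (u *m U^T) 0 k = tau * v k) ->
  gkernel tau u = gk v.
Proof.
move=> t0 UU uv; rewrite /gkernel /gk; congr expR.
have -> : u *m u^T = u *m U^T *m (u *m U^T)^T.
  by rewrite trmx_mul trmxK mulmxA -(mulmxA u) UU mulmx1.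
rewrite mxE (eq_bigr (fun k => tau ^+ 2 * v k ^+ 2)); last first.
  by move=> k _; rewrite [X in _ * X]mxE uv -exprMn expr2.
rewrite -mulr_sumr; field; exact: lt0r_neq0.
Qed.

(** Weighted averages commute with linear maps, and the weights agree because the rotation preserves
    norms while the scaling by [tau] matches the bandwidth. *)
Lemma gbms_rotate (R : realType) (p : nat) (tau : R) (U : 'M[R]_p) n
  (x : nat -> 'rV_p) (y : nat -> 'I_p -> R) :
  0 < tau -> U^T *m U = 1%:M -> (forall j k, (x j *m U^T) 0 k = tau * y j k) ->
  forall t i k, (gbms tau n x t i *m U^T) 0 k = tau * msiter n y t i k.
Proof.
move=> t0 UU xy; elim=> [//|t IH] i k.
rewrite /msiter iterS -/(msiter n y t) /= /msstep /msmean.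
set z := gbms tau n x t in IH *; set m := msiter n y t in IH *.
have ker j : gkernel tau (z i - z j) = gk (fun k => m i k - m j k).
  apply: (gkernel_rotate t0 UU) => l.
  by rewrite mulmxBl mxE [X in _ + X]mxE !IH mulrBr.
rewrite -scalemxAl mxE mulmx_suml summxE.
rewrite mulrCA; congr (_ * _).
  by congr (_^-1); apply: eq_bigr => j _; exact: ker.
rewrite mulr_sumr; apply: eq_bigr => j _.
by rewrite -scalemxAl mxE IH ker mulrCA.
Qed.

Theorem theorem2 (R : realType) (d : measure_display) (Omega : measurableType d)
  (P : probability Omega R) (p : nat) (S : 'M[R]_p) (tau : R)
  (x : nat -> Omega -> 'rV[R]_p) :
  posdef S -> 0 < tau ->
  (forall i, random_vector (x i)) ->
  mutually_independent P x ->
  (forall i, gaussian_vector P S (x i)) ->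
  {ae P, forall w, exists c : nat -> 'rV[R]_p,
      (forall n i, (i < n)%N ->
         gbms tau n (fun j => x j w) t i @[t --> \oo] --> c n) /\
      c n @[n --> \oo] --> (0 : 'rV[R]_p)}.
Proof.
move=> [ST Spos] tau0 rx ix gx.
have [U [UU /is_diag_mxP Udiag]] := spectral_symmetric ST.
have UU' : U^T *m U = 1%:M by exact: mulmx1C.
pose D k := (U *m S *m U^T) k k.
have D0 k : 0 < D k.
  have -> : D k = (row k U *m S *m (row k U)^T) 0 0.
    by rewrite -row_mul tr_row /D [LHS]mxE [RHS]mxE; apply: eq_bigr => l _; rewrite !mxE.
  apply: Spos; apply/eqP => r0.
  have := congr1 (fun M : 'M[R]_p => M k k) UU.
  rewrite !mxE eqxx big1 => [/eqP|l _]; first by rewrite eq_sym oner_eq0.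
  by have := congr1 (fun M : 'rV[R]_p => M 0 l) r0; rewrite !mxE => ->; rewrite mul0r.
have sD0 k : 0 < Num.sqrt (D k) by rewrite sqrtr_gt0.
(* [D k] are the eigenvalues of [S]. [W] is whitened, hence standard, and its deviations measured in
   units of [tau] are kept apart in [s]. *)
pose s k := Num.sqrt (D k) / tau.
pose W i w k := (x i w *m U^T) 0 k / Num.sqrt (D k).
have s0 k : 0 <= s k by rewrite divr_ge0// ltW.
pose bs := 1 + \sum_k s k.
have bs1 : 1 <= bs by rewrite lerDl sumr_ge0.
have sb k : 0 <= s k <= bs.
  by rewrite s0 /bs (bigD1 k)//= addrCA lerDl addr_ge0// sumr_ge0.
have sW i k : sigma_meas x i (fun w => W i w k).
  rewrite /sigma_meas /W; apply: measurable_funM => //.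
  rewrite (_ : (fun w => _) = fun w => \sum_l x i w 0 l * U k l); last first.
    by apply/funext => w; rewrite mxE; apply: eq_bigr => l _; rewrite [U^T _ _]mxE.
  by apply: measurable_sum => l; apply: measurable_funM => //; exact: sigma_meas_coord.
have gW i (a : 'I_p -> R) : 0 < \sum_k a k ^+ 2 ->
    forall B : set R, measurable B ->
    P [set w | B (\sum_k a k * W i w k)] = normal_prob 0 (Num.sqrt (\sum_k a k ^+ 2)) B.
  (* [\sum_k a k * W i w k] is the linear form of [x i w] with coefficients [al *m U]; its variance
     is [\sum_k a k ^ 2] because [U] diagonalises [S]. *)
  move=> a0 B mB; pose al := \row_k (a k / Num.sqrt (D k)).
  have v0 : al *m U != 0.
    apply/eqP => /(congr1 (mulmx^~ U^T)); rewrite -mulmxA UU mulmx1 mul0mx => al0.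
    move: a0; rewrite big1 ?ltxx// => k _.
    have /eqP := congr1 (fun M : 'rV[R]_p => M 0 k) al0; rewrite !mxE mulf_eq0 invr_eq0.
    by rewrite (gt_eqF (sD0 k)) orbF => /eqP ->; rewrite expr0n.
  have := gx i _ v0 B mB.
  have -> : ((al *m U) *m S *m (al *m U)^T) 0 0 = \sum_k a k ^+ 2.
    rewrite trmx_mul !mulmxA -(mulmxA al) -(mulmxA al) mxE; apply: eq_bigr => k _.
    rewrite mxE (bigD1 k)//= big1 => [|l lk]; last by rewrite Udiag// mulr0.
    rewrite addr0 -/(D k) !mxE -{2}(sqr_sqrtr (ltW (D0 k))); field; exact: lt0r_neq0.
  move=> <-; congr (P _); apply/seteqP; split=> w /=.
    move=> h; apply/mem_set; move: h; congr B.
    rewrite trmx_mul mulmxA [RHS]mxE; apply: eq_bigr => k _.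
    by rewrite ![in RHS]mxE /W; rewrite mxE; ring.
  move=> /set_mem; congr B.
  rewrite trmx_mul mulmxA [LHS]mxE; apply: eq_bigr => k _.
  by rewrite ![in LHS]mxE /W; rewrite mxE; ring.
have := msiter_gaussian_ae rx ix sW gW bs1 sb.
apply: filterS => w [L [Lt L0]].
exists (fun n => (\row_k (tau * L n k)) *m U); split=> [n i iN|].
  rewrite (_ : (fun t => _) = fun t => (\row_k (tau * msiter n (fun j k => s k * W j w k) t i k)) *m U).
    apply: cvg_rV_mulmx => k; rewrite mxE.
    rewrite (_ : (fun t => _) = fun t => tau * msiter n (fun j k => s k * W j w k) t i k); last first.
      by apply/funext => t; rewrite mxE.
    by apply: cvgM; [exact: cvg_cst|exact: Lt].
  apply/funext => t; rewrite -[LHS]mulmx1 -UU' mulmxA; congr (_ *m _).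
  apply/rowP => k; rewrite [RHS]mxE; apply: gbms_rotate => // j l.
  rewrite /s /W; field; rewrite !gt_eqF//.
rewrite -(mul0mx _ U); apply: cvg_rV_mulmx => k; rewrite mxE.
rewrite (_ : (fun t => _) = fun n => tau * L n k); last first.
  by apply/funext => t; rewrite mxE.
by rewrite -[X in _ --> X](mulr0 tau); apply: cvgM; [exact: cvg_cst|exact: L0].
Qed.
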